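(* Let $\mathcal{B}$ be a bicategory and $\mathfrak{W}$ a class of arrows in $\mathcal{B}$ that satisfies conditions [WB1]--[WB5], is pullback closed, and all of whose arrows are full and co-full; assume $\mathcal{B}$ has all pseudo pullbacks of cospans in $\mathfrak{W}$, and fix a choice of them. Consider spans $(u_1,f_1),(u_2,f_2)\colon A\to B$ (apexes $A',A''$) and $(v_1,g_1),(v_2,g_2)\colon B\to C$ (apexes $B',B''$) in $\mathcal{B}(\mathfrak{W}^{-1})$, and 2-cells $[\rho_{u_1,u_2},\beta]\colon(u_1,f_1)\Rightarrow(u_2,f_2)$ and $[\rho_{v_1,v_2},\gamma]\colon(v_1,g_1)\Rightarrow(v_2,g_2)$ represented by the 2-cell diagrams $(\rho_{u_1,u_2},\beta;\pi_{A'},\pi_{A''})$ and $(\rho_{v_1,v_2},\gamma;\pi_{B'},\pi_{B''})$, whose left-hand 2-cells are the chosen pseudo pullbacks. Let $\delta_i\colon v_i\overline{f}_i\Rightarrow f_i\overline{v}_i$ ($i=1,2$) be the chosen invertible squares defining the composite spans $(u_1\overline{v}_1,g_1\overline{f}_1)$ (apex $D$) and $(u_2\overline{v}_2,g_2\overline{f}_2)$ (apex $D'$), and let $P_{u_1\overline{v}_1,u_2\overline{v}_2}$ with projections $\pi_D,\pi_{D'}$ and 2-cell $\rho_{u_1\overline{v}_1,u_2\overline{v}_2}$ be the chosen pseudo pullback of $u_1\overline{v}_1$ and $u_2\overline{v}_2$. Let $w_{u_1,u_2}\colon P_{u_1\overline{v}_1,u_2\overline{v}_2}\to P_{u_1,u_2}$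 be the unique arrow with $\pi_{A'}w_{u_1,u_2}=\overline{v}_1\pi_D$, $\pi_{A''}w_{u_1,u_2}=\overline{v}_2\pi_{D'}$ and $\rho_{u_1,u_2}w_{u_1,u_2}=\rho_{u_1\overline{v}_1,u_2\overline{v}_2}$. If $\beta$ is invertible, let $w_{v_1,v_2}\colon P_{u_1\overline{v}_1,u_2\overline{v}_2}\to P_{v_1,v_2}$ be the unique arrow with $\pi_{B'}w_{v_1,v_2}=\overline{f}_1\pi_D$, $\pi_{B''}w_{v_1,v_2}=\overline{f}_2\pi_{D'}$ and $$\rho_{v_1,v_2}w_{v_1,v_2}=(\delta_2^{-1}\pi_{D'})\,(\beta w_{u_1,u_2})\,(\delta_1\pi_D).$$ Then the horizontal composition of $[\rho_{u_1,u_2},\beta]$ and $[\rho_{v_1,v_2},\gamma]$ in $\mathcal{B}(\mathfrak{W}^{-1})$ is represented by the 2-cell diagram $$(\rho_{u_1\overline{v}_1,u_2\overline{v}_2},\ \gamma w_{v_1,v_2};\ \pi_D,\pi_{D'})\colon (u_1\overline{v}_1,g_1\overline{f}_1)\Rightarrow(u_2\overline{v}_2,g_2\overline{f}_2).$$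
   Context: Associativity and unit constraints are suppressed (composites are treated as strictly associative); $gf$ is $f$ followed by $g$; $\alpha f$, $g\alpha$ are whiskerings; $(\beta)(\alpha)$ is vertical composition ($\alpha$ first). An arrow $w$ is full if for any $\alpha\colon wf\Rightarrow wg$ there is $\tilde\alpha\colon f\Rightarrow g$ with $w\tilde\alpha=\alpha$; co-full if for any $\alpha\colon fw\Rightarrow gw$ there is $\alpha'\colon f\Rightarrow g$ with $\alpha'w=\alpha$. **Pseudo pullbacks.** A pseudo pullback of $u\colon A'\to A$, $v\colon A''\to A$ is an object $P_{u,v}$ with projections $\pi_1\colon P_{u,v}\to A'$, $\pi_2\colon P_{u,v}\to A''$ and an invertible $\rho_{u,v}\colon u\pi_1\Rightarrow v\pi_2$ such that for all $a\colon X\to A'$, $b\colon X\to A''$ and invertible $\sigma\colon ua\Rightarrow vb$ there is a unique $h\colon X\to P_{u,v}$ with $\pi_1h=a$, $\pi_2h=b$, $\rho_{u,v}h=\sigma$, and the corresponding 2-dimensional property holds (2-cells $\xi\colon\pi_1h\Rightarrow\pi_1h'$, $\zeta\colon\pi_2h\Rightarrow\pi_2h'$ with $(v\zeta)(\rho_{u,v}h)=(\rho_{u,v}h')(u\xi)$ come from a unique 2-cell $h\Rightarrow h'$). $\mathfrak{W}$ is pullback closed if for any pseudo pullback of $u,v\in\mathfrak{W}$, the composite $v\pi_2$ (equivalently $u\pi_1$) is in $\mathfrak{W}$. The projections of $P_{u_1,u_2}$ are written $\pi_{A'},\pi_{A''}$, those of $P_{v_1,v_2}$ are $\pi_{B'},\pi_{B''}$.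 **Conditions on $\mathfrak{W}$.** [WB1] All identities are in $\mathfrak{W}$. [WB2] For composable $v\colon B\to C$, $w\colon C\to D$ in $\mathfrak{W}$ there is an arrow $u\colon A\to B$ with $wvu\in\mathfrak{W}$. [WB3] For $w\colon A\to B$ in $\mathfrak{W}$ and $f\colon C\to B$ there are $h\colon D\to A$, $v\colon D\to C$ with $v\in\mathfrak{W}$ and an invertible 2-cell $\alpha\colon wh\Rightarrow fv$. [WB4] For any 2-cell $\alpha\colon wf\Rightarrow wg$ with $w\in\mathfrak{W}$ there are $u\in\mathfrak{W}$ and a 2-cell $\beta\colon fu\Rightarrow gu$ with $\alpha u=w\beta$; and if $(u_1,\beta_1)$, $(u_2,\beta_2)$ are two such pairs, there are arrows $s,t$ with $u_1s,u_2t\in\mathfrak{W}$ and an invertible 2-cell $\varepsilon\colon u_1s\Rightarrow u_2t$ with $(g\varepsilon)(\beta_1s)=(\beta_2t)(f\varepsilon)$. [WB5] If $w\in\mathfrak{W}$ and there is an invertible 2-cell $v\Rightarrow w$, then $v\in\mathfrak{W}$. **The bicategory of fractions $\mathcal{B}(\mathfrak{W}^{-1})$.** Objects are those of $\mathcal{B}$. An arrow $A\to B$ is a span $(u,f)$: $A\xleftarrow{u}C\xrightarrow{f}B$ with $u\in\mathfrak{W}$. A 2-cell diagram from $(u_1,f_1)$ (apex $C_1$) to $(u_2,f_2)$ (apex $C_2$) is a tuple $(\alpha,\beta;s_1,s_2)$ with $s_i\colon D\to C_i$, an invertible $\alpha\colon u_1s_1\Rightarrow u_2s_2$ (left-hand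 2-cell) and $\beta\colon f_1s_1\Rightarrow f_2s_2$ (right-hand 2-cell), such that $u_1s_1\in\mathfrak{W}$. It is equivalent to $(\alpha',\beta';s_1',s_2')$ iff there are arrows $p,q$ with common domain and invertible $\varepsilon_i\colon s_ip\Rightarrow s_i'q$ with $u_1s_1p\in\mathfrak{W}$, $(u_2\varepsilon_2)(\alpha p)=(\alpha'q)(u_1\varepsilon_1)$ and $(f_2\varepsilon_2)(\beta p)=(\beta'q)(f_1\varepsilon_1)$. 2-cells are equivalence classes. *Arrow composition:* for $(u,f)\colon A\to B$ and $(v,g)\colon B\to C$ there is a fixed chosen invertible square $v\overline{f}\Rightarrow f\overline{v}$ with $u\overline{v}\in\mathfrak{W}$; the composite is $(u\overline{v},g\overline{f})$. *Vertical composition* of $(\alpha_1,\beta_1;s_1,s_2)\colon(u_1,f_1)\Rightarrow(u_2,f_2)$ and $(\alpha_2,\beta_2;s_3,s_4)\colon(u_2,f_2)\Rightarrow(u_3,f_3)$: choose $x_1,x_2$ and an invertible $\delta\colon s_2x_1\Rightarrow s_3x_2$ with $u_2s_2x_1\in\mathfrak{W}$; the composite is represented by $((\alpha_2x_2)(u_2\delta)(\alpha_1x_1),(\beta_2x_2)(f_2\delta)(\beta_1x_1);s_1x_1,s_4x_2)$. *Left whiskering* of $(\alpha,\beta;s_1,s_2)\colon(u_1,f_1)\Rightarrow(u_2,f_2)$ with $(v,g)$ composed after it, with chosen squares $\gamma_i\colon v\overline{f}_i\Rightarrow f_i\overline{v}_i$: choose $p_1,p_2,k$, invertible $\mu_1\colon\overline{v}_1p_1\Rightarrow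 s_1k$, $\mu_2\colon s_2k\Rightarrow\overline{v}_2p_2$ and $\tilde\beta\colon\overline{f}_1p_1\Rightarrow\overline{f}_2p_2$ with $v\tilde\beta=(\gamma_2^{-1}p_2)(f_2\mu_2)(\beta k)(f_1\mu_1)(\gamma_1p_1)$ and $u_1\overline{v}_1p_1\in\mathfrak{W}$; the result is represented by $((u_2\mu_2)(\alpha k)(u_1\mu_1),g\tilde\beta;p_1,p_2)$. *Right whiskering* of $(\alpha,\beta;s_1,s_2)\colon(v_1,g_1)\Rightarrow(v_2,g_2)$ with $(u,f)$ composed before it, with chosen squares $\gamma_i\colon v_i\overline{f}_i\Rightarrow f\overline{v}_i$: choose $p_1,p_2,h$ and invertible $\lambda\colon\overline{v}_1p_1\Rightarrow\overline{v}_2p_2$, $\kappa_1\colon\overline{f}_1p_1\Rightarrow s_1h$, $\kappa_2\colon s_2h\Rightarrow\overline{f}_2p_2$ with $u\overline{v}_1p_1\in\mathfrak{W}$ and $(\gamma_2p_2)(v_2\kappa_2)(\alpha h)(v_1\kappa_1)=(f\lambda)(\gamma_1p_1)$; the result is represented by $(u\lambda,(g_2\kappa_2)(\beta h)(g_1\kappa_1);p_1,p_2)$. *Horizontal composition* of 2-cells $\Phi\colon(u_1,f_1)\Rightarrow(u_2,f_2)$ and $\Psi\colon(v_1,g_1)\Rightarrow(v_2,g_2)$ is the vertical composite of the left whiskering of $\Phi$ with $(v_1,g_1)$ followed by the right whiskering of $\Psi$ with $(u_2,f_2)$. *)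

(* Defs.v *)
Set Implicit Arguments.
Unset Strict Implicit.
Unset Printing Implicit Defensive.

(** Weak bicategories, in the presentation by whiskerings.  [comp g f] is [f]
    followed by [g]; [vc b a] is [a] followed by [b]; 2-cells are compared by
    Leibniz equality. *)
Record bicategory := Bicategory {
  ob :> Type;
  hom : ob -> ob -> Type;
  cell : forall A B : ob, hom A B -> hom A B -> Type;
  id1 : forall A : ob, hom A A;
  comp : forall A B C : ob, hom B C -> hom A B -> hom A C;
  id2 : forall (A B : ob) (f : hom A B), cell f f;
  vc : forall (A B : ob) (f g h : hom A B), cell g h -> cell f g -> cell f h;
  lw : forall (A B C : ob) (k : hom B C) (f g : hom A B),
    cell f g -> cell (comp k f) (comp k g);
  rw : forall (A B C : ob) (f g : hom B C),
    cell f g -> forall k : hom A B, cell (comp f k) (comp g k);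
  asc : forall (A B C D : ob) (h : hom C D) (g : hom B C) (f : hom A B),
    cell (comp (comp h g) f) (comp h (comp g f));
  asci : forall (A B C D : ob) (h : hom C D) (g : hom B C) (f : hom A B),
    cell (comp h (comp g f)) (comp (comp h g) f);
  lun : forall (A B : ob) (f : hom A B), cell (comp (id1 B) f) f;
  luni : forall (A B : ob) (f : hom A B), cell f (comp (id1 B) f);
  run : forall (A B : ob) (f : hom A B), cell (comp f (id1 A)) f;
  runi : forall (A B : ob) (f : hom A B), cell f (comp f (id1 A));
  vc_id_l : forall (A B : ob) (f g : hom A B) (a : cell f g),
    vc (id2 g) a = a;
  vc_id_r : forall (A B : ob) (f g : hom A B) (a : cell f g),
    vc a (id2 f) = a;
  vc_assoc : forall (A B : ob) (f g h k : hom A B)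
    (c : cell h k) (b : cell g h) (a : cell f g),
    vc c (vc b a) = vc (vc c b) a;
  lw_id : forall (A B C : ob) (k : hom B C) (f : hom A B),
    lw k (id2 f) = id2 (comp k f);
  lw_vc : forall (A B C : ob) (k : hom B C) (f g h : hom A B)
    (b : cell g h) (a : cell f g),
    lw k (vc b a) = vc (lw k b) (lw k a);
  rw_id : forall (A B C : ob) (f : hom B C) (k : hom A B),
    rw (id2 f) k = id2 (comp f k);
  rw_vc : forall (A B C : ob) (f g h : hom B C)
    (b : cell g h) (a : cell f g) (k : hom A B),
    rw (vc b a) k = vc (rw b k) (rw a k);
  interchange : forall (A B C : ob) (f f' : hom A B) (g g' : hom B C)
    (a : cell f f') (b : cell g g'),
    vc (rw b f') (lw g a) = vc (lw g' a) (rw b f);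
  asc_nat_l : forall (A B C D : ob) (h h' : hom C D) (g : hom B C)
    (f : hom A B) (a : cell h h'),
    vc (asc h' g f) (rw (rw a g) f) = vc (rw a (comp g f)) (asc h g f);
  asc_nat_m : forall (A B C D : ob) (h : hom C D) (g g' : hom B C)
    (f : hom A B) (a : cell g g'),
    vc (asc h g' f) (rw (lw h a) f) = vc (lw h (rw a f)) (asc h g f);
  asc_nat_r : forall (A B C D : ob) (h : hom C D) (g : hom B C)
    (f f' : hom A B) (a : cell f f'),
    vc (asc h g f') (lw (comp h g) a) = vc (lw h (lw g a)) (asc h g f);
  lun_nat : forall (A B : ob) (f f' : hom A B) (a : cell f f'),
    vc a (lun f) = vc (lun f') (lw (id1 B) a);
  run_nat : forall (A B : ob) (f f' : hom A B) (a : cell f f'),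
    vc a (run f) = vc (run f') (rw a (id1 A));
  asc_asci : forall (A B C D : ob) (h : hom C D) (g : hom B C) (f : hom A B),
    vc (asc h g f) (asci h g f) = id2 (comp h (comp g f));
  asci_asc : forall (A B C D : ob) (h : hom C D) (g : hom B C) (f : hom A B),
    vc (asci h g f) (asc h g f) = id2 (comp (comp h g) f);
  lun_luni : forall (A B : ob) (f : hom A B), vc (lun f) (luni f) = id2 f;
  luni_lun : forall (A B : ob) (f : hom A B),
    vc (luni f) (lun f) = id2 (comp (id1 B) f);
  run_runi : forall (A B : ob) (f : hom A B), vc (run f) (runi f) = id2 f;
  runi_run : forall (A B : ob) (f : hom A B),
    vc (runi f) (run f) = id2 (comp f (id1 A));
  triangle : forall (A B C : ob) (g : hom B C) (f : hom A B),
    vc (lw g (lun f)) (asc g (id1 B) f) = rw (run g) f;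
  pentagon : forall (A B C D E : ob) (k : hom D E) (h : hom C D)
    (g : hom B C) (f : hom A B),
    vc (asc k h (comp g f)) (asc (comp k h) g f)
    = vc (vc (lw k (asc h g f)) (asc k (comp h g) f)) (rw (asc k h g) f)
}.

Arguments hom {_} _ _.
Arguments cell {_} {_} {_} _ _.
Arguments id1 {_} _.
Arguments comp {_} {_} {_} {_} _ _.
Arguments id2 {_} {_} {_} _.
Arguments vc {_} {_} {_} {_} {_} {_} _ _.
Arguments lw {_} {_} {_} {_} _ {_} {_} _.
Arguments rw {_} {_} {_} {_} {_} {_} _ _.
Arguments asc {_} {_} {_} {_} {_} _ _ _.
Arguments asci {_} {_} {_} {_} {_} _ _ _.
Arguments lun {_} {_} {_} _.
Arguments luni {_} {_} {_} _.
Arguments run {_} {_} {_} _.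
Arguments runi {_} {_} {_} _.

Declare Scope bicat_scope.
Delimit Scope bicat_scope with bicat.
Open Scope bicat_scope.

Notation "g ∘ f" := (comp g f) (at level 40, left associativity) : bicat_scope.
Notation "k ◁ a" := (lw k a) (at level 45, no associativity) : bicat_scope.
Notation "a ▷ k" := (rw a k) (at level 45, no associativity) : bicat_scope.
Notation "b • a" := (vc b a) (at level 50, left associativity) : bicat_scope.
Notation "f ⇒ g" := (cell f g) (at level 60, no associativity) : bicat_scope.

(** Invertible 2-cells.  The inverse is data, but it is determined by the
    2-cell. *)
Record icell (B : bicategory) (X Y : B) (f g : hom X Y) := ICell {
  icell_cell :> f ⇒ g;
  icell_inv : g ⇒ f;
  icell_invl : icell_inv • icell_cell = id2 f;
  icell_invr : icell_cell • icell_inv = id2 g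
}.

Definition invertible (B : bicategory) (X Y : B) (f g : hom X Y)
    (a : f ⇒ g) : Prop :=
  exists i : icell f g, icell_cell i = a.

(** The identity 2-cell between two equal arrows. *)
Definition eqc (B : bicategory) (X Y : B) (f g : hom X Y) (e : f = g) : f ⇒ g :=
  match e in _ = g' return f ⇒ g' with eq_refl => id2 f end.

(** [awr b s] and [awl h b] are the whiskerings [b s] and [h b] of a 2-cell
    [b : fu ⇒ gv] between composite arrows, with the associativity constraints that bring source and target
    back to composites of two (possibly composite) arrows. *)
Definition awr (B : bicategory) (X Y Y' Z T : B)
    (f : hom Y Z) (u : hom X Y) (g : hom Y' Z) (v : hom X Y')
    (b : f ∘ u ⇒ g ∘ v) (s : hom T X) : f ∘ (u ∘ s) ⇒ g ∘ (v ∘ s) :=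
  asc g v s • (b ▷ s) • asci f u s.

Definition awl (B : bicategory) (X Y Y' Z T : B) (h : hom Z T)
    (f : hom Y Z) (u : hom X Y) (g : hom Y' Z) (v : hom X Y')
    (b : f ∘ u ⇒ g ∘ v) : (h ∘ f) ∘ u ⇒ (h ∘ g) ∘ v :=
  asci h g v • (h ◁ b) • asc h f u.

(** [b s] once more, read as a 2-cell [f a ⇒ g a'] along equalities of arrows
    [u s = a] and [v s = a']. *)
Definition awr_along (B : bicategory) (X Y Y' Z T : B)
    (f : hom Y Z) (u : hom X Y) (g : hom Y' Z) (v : hom X Y')
    (b : f ∘ u ⇒ g ∘ v) (s : hom T X) (a : hom T Y) (a' : hom T Y')
    (e : u ∘ s = a) (e' : v ∘ s = a') : f ∘ a ⇒ g ∘ a' :=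
  (g ◁ eqc e') • awr b s • (f ◁ eqc (eq_sym e)).

Section InvertibleCells.
Context (B : bicategory).

Lemma vc_inv (X Y : B) (f g h : hom X Y)
    (b : g ⇒ h) (b' : h ⇒ g) (a : f ⇒ g) (a' : g ⇒ f) :
  b' • b = id2 g -> a' • a = id2 f -> (a' • b') • (b • a) = id2 f.
Proof.
intros Hb Ha. rewrite vc_assoc, <- (vc_assoc a' b' b), Hb, vc_id_r. exact Ha.
Qed.

Definition ivc (X Y : B) (f g h : hom X Y) (b : icell g h) (a : icell f g) :
    icell f h :=
  @ICell B X Y f h (b • a) (icell_inv a • icell_inv b)
    (vc_inv (icell_invl b) (icell_invl a))
    (vc_inv (icell_invr a) (icell_invr b)).

Lemma lw_inv (X Y Z : B) (k : hom Y Z) (f g : hom X Y) (a : f ⇒ g) (a' : g ⇒ f) :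
  a' • a = id2 f -> (k ◁ a') • (k ◁ a) = id2 (k ∘ f).
Proof. intros Ha. rewrite <- lw_vc, Ha. apply lw_id. Qed.

Definition ilw (X Y Z : B) (k : hom Y Z) (f g : hom X Y) (a : icell f g) :
    icell (k ∘ f) (k ∘ g) :=
  @ICell B X Z (k ∘ f) (k ∘ g) (k ◁ a) (k ◁ icell_inv a)
    (lw_inv k (icell_invl a)) (lw_inv k (icell_invr a)).

Lemma rw_inv (X Y Z : B) (f g : hom Y Z) (a : f ⇒ g) (a' : g ⇒ f) (k : hom X Y) :
  a' • a = id2 f -> (a' ▷ k) • (a ▷ k) = id2 (f ∘ k).
Proof. intros Ha. rewrite <- rw_vc, Ha. apply rw_id. Qed.

Definition irw (X Y Z : B) (f g : hom Y Z) (a : icell f g) (k : hom X Y) :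
    icell (f ∘ k) (g ∘ k) :=
  @ICell B X Z (f ∘ k) (g ∘ k) (a ▷ k) (icell_inv a ▷ k)
    (rw_inv k (icell_invl a)) (rw_inv k (icell_invr a)).

Definition iasc (X Y Z T : B) (h : hom Z T) (g : hom Y Z) (f : hom X Y) :
    icell ((h ∘ g) ∘ f) (h ∘ (g ∘ f)) :=
  ICell (asci_asc h g f) (asc_asci h g f).

Definition iasci (X Y Z T : B) (h : hom Z T) (g : hom Y Z) (f : hom X Y) :
    icell (h ∘ (g ∘ f)) ((h ∘ g) ∘ f) :=
  ICell (asc_asci h g f) (asci_asc h g f).

Definition iawr (X Y Y' Z T : B)
    (f : hom Y Z) (u : hom X Y) (g : hom Y' Z) (v : hom X Y')
    (b : icell (f ∘ u) (g ∘ v)) (s : hom T X) :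
    icell (f ∘ (u ∘ s)) (g ∘ (v ∘ s)) :=
  ivc (ivc (iasc g v s) (irw b s)) (iasci f u s).

Definition iawl (X Y Y' Z T : B) (h : hom Z T)
    (f : hom Y Z) (u : hom X Y) (g : hom Y' Z) (v : hom X Y')
    (b : icell (f ∘ u) (g ∘ v)) : icell ((h ∘ f) ∘ u) ((h ∘ g) ∘ v) :=
  ivc (ivc (iasci h g v) (ilw h b)) (iasc h f u).

End InvertibleCells.

Definition arrow_class (B : bicategory) : Type :=
  forall X Y : B, hom X Y -> Prop.

Definition full (B : bicategory) (X Y : B) (w : hom X Y) : Prop :=
  forall (T : B) (f g : hom T X) (a : w ∘ f ⇒ w ∘ g),
    exists a' : f ⇒ g, w ◁ a' = a.

Definition cofull (B : bicategory) (X Y : B) (w : hom X Y) : Prop :=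
  forall (T : B) (f g : hom Y T) (a : f ∘ w ⇒ g ∘ w),
    exists a' : f ⇒ g, a' ▷ w = a.

Section Conditions.
Context (B : bicategory) (W : arrow_class B).

Definition WB1 : Prop := forall X : B, W (id1 X).

Definition WB2 : Prop :=
  forall (X Y Z : B) (v : hom X Y) (w : hom Y Z), W v -> W w ->
    exists (T : B) (u : hom T X), W (w ∘ (v ∘ u)).

Definition WB3 : Prop :=
  forall (X Y Z : B) (w : hom X Y) (f : hom Z Y), W w ->
    exists (D : B) (h : hom D X) (v : hom D Z),
      W v /\ inhabited (icell (w ∘ h) (f ∘ v)).

Definition lifting (X Y Z : B) (w : hom Y Z) (f g : hom X Y)
    (a : w ∘ f ⇒ w ∘ g) (D : B) (u : hom D X) (b : f ∘ u ⇒ g ∘ u) : Prop :=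
  W u /\ awr a u = w ◁ b.

Definition WB4 : Prop :=
  forall (X Y Z : B) (w : hom Y Z) (f g : hom X Y) (a : w ∘ f ⇒ w ∘ g), W w ->
    (exists (D : B) (u : hom D X) (b : f ∘ u ⇒ g ∘ u), lifting a b) /\
    (forall (D1 : B) (u1 : hom D1 X) (b1 : f ∘ u1 ⇒ g ∘ u1)
            (D2 : B) (u2 : hom D2 X) (b2 : f ∘ u2 ⇒ g ∘ u2),
      lifting a b1 -> lifting a b2 ->
      exists (E : B) (s : hom E D1) (t : hom E D2)
             (e : icell (u1 ∘ s) (u2 ∘ t)),
        W (u1 ∘ s) /\ W (u2 ∘ t) /\
        (g ◁ e) • awr b1 s = awr b2 t • (f ◁ e)).

Definition WB5 : Prop :=
  forall (X Y : B) (v w : hom X Y), W w -> icell v w -> W v.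

Record WBconditions : Prop := {
  wb1 : WB1; wb2 : WB2; wb3 : WB3; wb4 : WB4; wb5 : WB5
}.

End Conditions.

Section PseudoPullbacks.
Context (B : bicategory).

Record pseudo_pullback (X' X'' X : B) (u : hom X' X) (v : hom X'' X) :=
  PseudoPullback {
  pp_ob : B;
  pp_pi1 : hom pp_ob X';
  pp_pi2 : hom pp_ob X'';
  pp_rho : icell (u ∘ pp_pi1) (v ∘ pp_pi2);
  pp_univ1 : forall (T : B) (a : hom T X') (b : hom T X'')
    (sigma : icell (u ∘ a) (v ∘ b)),
    exists! h : hom T pp_ob,
      exists (e1 : pp_pi1 ∘ h = a) (e2 : pp_pi2 ∘ h = b),
        awr_along pp_rho e1 e2 = sigma;
  pp_univ2 : forall (T : B) (h h' : hom T pp_ob)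
    (xi : pp_pi1 ∘ h ⇒ pp_pi1 ∘ h') (zeta : pp_pi2 ∘ h ⇒ pp_pi2 ∘ h'),
    (v ◁ zeta) • awr pp_rho h = awr pp_rho h' • (u ◁ xi) ->
    exists! theta : h ⇒ h', pp_pi1 ◁ theta = xi /\ pp_pi2 ◁ theta = zeta
}.

Context (W : arrow_class B).

Definition pullback_closed : Prop :=
  forall (X' X'' X : B) (u : hom X' X) (v : hom X'' X), W u -> W v ->
    forall P : pseudo_pullback u v, W (v ∘ pp_pi2 P).

Definition pullback_choice : Type :=
  forall (X' X'' X : B) (u : hom X' X) (v : hom X'' X), W u -> W v ->
    pseudo_pullback u v.

End PseudoPullbacks.

(** Arrows of the bicategory of fractions. *)
Record span (B : bicategory) (W : arrow_class B) (X Y : B) := Span {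
  apex : B;
  leg : hom apex X;
  arr : hom apex Y;
  leg_in : W apex X leg
}.

(** A square [v fbar ⇒ f vbar] completing [X <-u- . -f-> Y <-v- . -g-> Z]. *)
Record square (B : bicategory) (W : arrow_class B) (X Y Z : B)
    (F : span W X Y) (G : span W Y Z) := Square {
  sq_ob : B;
  fbar : hom sq_ob (apex G);
  vbar : hom sq_ob (apex F);
  sq_cell : icell (leg G ∘ fbar) (arr F ∘ vbar);
  sq_in : W sq_ob X (leg F ∘ vbar)
}.

Definition square_choice (B : bicategory) (W : arrow_class B) : Type :=
  forall (X Y Z : B) (F : span W X Y) (G : span W Y Z), square F G.

Definition span_comp (B : bicategory) (W : arrow_class B)
    (sq : square_choice W) (X Y Z : B) (F : span W X Y) (G : span W Y Z) :
    span W X Z :=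
  @Span B W X Z (sq_ob (sq X Y Z F G)) (leg F ∘ vbar (sq X Y Z F G))
    (arr G ∘ fbar (sq X Y Z F G)) (sq_in (sq X Y Z F G)).

(** 2-cell diagrams [(alpha, beta; s1, s2)]. *)
Record diagram (B : bicategory) (W : arrow_class B) (X Y : B)
    (F1 F2 : span W X Y) := Diagram {
  dg_ob : B;
  dg1 : hom dg_ob (apex F1);
  dg2 : hom dg_ob (apex F2);
  dgL : icell (leg F1 ∘ dg1) (leg F2 ∘ dg2);
  dgR : arr F1 ∘ dg1 ⇒ arr F2 ∘ dg2;
  dg_in : W dg_ob X (leg F1 ∘ dg1)
}.

Section TwoCells.
Context (B : bicategory) (W : arrow_class B).

Definition diagram_equiv (X Y : B) (F1 F2 : span W X Y)
    (d d' : diagram F1 F2) : Prop :=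
  exists (T : B) (p : hom T (dg_ob d)) (q : hom T (dg_ob d'))
    (e1 : icell (dg1 d ∘ p) (dg1 d' ∘ q))
    (e2 : icell (dg2 d ∘ p) (dg2 d' ∘ q)),
    W (leg F1 ∘ (dg1 d ∘ p)) /\
    (leg F2 ◁ e2) • awr (dgL d) p = awr (dgL d') q • (leg F1 ◁ e1) /\
    (arr F2 ◁ e2) • awr (dgR d) p = awr (dgR d') q • (arr F1 ◁ e1).

(** 2-cells of the bicategory of fractions are classes of 2-cell diagrams,
    given as sets of diagrams; they are compared extensionally. *)
Definition diagram_set (X Y : B) (F1 F2 : span W X Y) : Type :=
  diagram F1 F2 -> Prop.

Definition cls (X Y : B) (F1 F2 : span W X Y) (d : diagram F1 F2) :
    diagram_set F1 F2 :=
  fun d' => diagram_equiv d d'.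

Definition same_class (X Y : B) (F1 F2 : span W X Y)
    (Phi Psi : diagram_set F1 F2) : Prop :=
  forall d : diagram F1 F2, Phi d <-> Psi d.

(** The three operations below are first given on diagrams, for every
    admissible choice of the auxiliary data.  The operation on classes sends
    them to the set of all diagrams equivalent to a result obtained from some
    representatives and some choice of data. *)

Section Vertical.
Context (X Y : B) (F1 F2 F3 : span W X Y).

Record vcomp_data (d1 : diagram F1 F2) (d2 : diagram F2 F3) := VcompData {
  vd_ob : B;
  vd_x1 : hom vd_ob (dg_ob d1);
  vd_x2 : hom vd_ob (dg_ob d2);
  vd_delta : icell (dg2 d1 ∘ vd_x1) (dg1 d2 ∘ vd_x2);
  vd_in : W (leg F2 ∘ (dg2 d1 ∘ vd_x1))
}.

Definition vcomp_diagram (H5 : WB5 W) (d1 : diagram F1 F2) (d2 : diagram F2 F3)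
    (c : vcomp_data d1 d2) : diagram F1 F3 :=
  @Diagram B W X Y F1 F3 (vd_ob c) (dg1 d1 ∘ vd_x1 c) (dg2 d2 ∘ vd_x2 c)
    (ivc (ivc (iawr (dgL d2) (vd_x2 c)) (ilw (leg F2) (vd_delta c)))
         (iawr (dgL d1) (vd_x1 c)))
    (awr (dgR d2) (vd_x2 c) • (arr F2 ◁ vd_delta c) • awr (dgR d1) (vd_x1 c))
    (H5 _ _ _ _ (vd_in c) (iawr (dgL d1) (vd_x1 c))).

Definition vcomp (H5 : WB5 W) (Phi : diagram_set F1 F2)
    (Psi : diagram_set F2 F3) : diagram_set F1 F3 :=
  fun d => exists (d1 : diagram F1 F2) (d2 : diagram F2 F3)
    (c : vcomp_data d1 d2),
    Phi d1 /\ Psi d2 /\ diagram_equiv (vcomp_diagram H5 c) d.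

End Vertical.

Section Whiskerings.
Context (sq : square_choice W) (X Y Z : B).

(** The equation [v btilde = (gamma2^-1 p2)(f2 mu2)(beta k)(f1 mu1)(gamma1 p1)]
    for [F1 = (u1, f1)], [F2 = (u2, f2)], [G = (v, g)]. *)
Record lwhisk_data (F1 F2 : span W X Y) (d : diagram F1 F2) (G : span W Y Z) :=
  LwhiskData {
  ld_ob : B;
  ld_p1 : hom ld_ob (sq_ob (sq F1 G));
  ld_p2 : hom ld_ob (sq_ob (sq F2 G));
  ld_k : hom ld_ob (dg_ob d);
  ld_mu1 : icell (vbar (sq F1 G) ∘ ld_p1) (dg1 d ∘ ld_k);
  ld_mu2 : icell (dg2 d ∘ ld_k) (vbar (sq F2 G) ∘ ld_p2);
  ld_btilde : fbar (sq F1 G) ∘ ld_p1 ⇒ fbar (sq F2 G) ∘ ld_p2;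
  ld_eq : leg G ◁ ld_btilde
    = awr (icell_inv (sq_cell (sq F2 G))) ld_p2 • (arr F2 ◁ ld_mu2)
      • awr (dgR d) ld_k • (arr F1 ◁ ld_mu1)
      • awr (sq_cell (sq F1 G)) ld_p1;
  ld_in : W ((leg F1 ∘ vbar (sq F1 G)) ∘ ld_p1)
}.

Definition lwhisk_diagram (F1 F2 : span W X Y) (d : diagram F1 F2)
    (G : span W Y Z) (c : lwhisk_data d G) :
    diagram (span_comp sq F1 G) (span_comp sq F2 G) :=
  @Diagram B W X Z (span_comp sq F1 G) (span_comp sq F2 G)
    (ld_ob c) (ld_p1 c) (ld_p2 c)
    (ivc (ivc (ivc (ivc
       (iasci (leg F2) (vbar (sq F2 G)) (ld_p2 c))
       (ilw (leg F2) (ld_mu2 c)))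
       (iawr (dgL d) (ld_k c)))
       (ilw (leg F1) (ld_mu1 c)))
       (iasc (leg F1) (vbar (sq F1 G)) (ld_p1 c)))
    (awl (arr G) (ld_btilde c))
    (ld_in c).

Definition lwhisk (F1 F2 : span W X Y) (Phi : diagram_set F1 F2)
    (G : span W Y Z) : diagram_set (span_comp sq F1 G) (span_comp sq F2 G) :=
  fun d => exists (d1 : diagram F1 F2) (c : lwhisk_data d1 G),
    Phi d1 /\ diagram_equiv (lwhisk_diagram c) d.

Arguments lwhisk {F1 F2} Phi G _.

(** The equation [(gamma2 p2)(v2 kappa2)(alpha h)(v1 kappa1) =
    (f lambda)(gamma1 p1)] for [F = (u, f)], [Gi = (vi, gi)]. *)
Record rwhisk_data (F : span W X Y) (G1 G2 : span W Y Z) (d : diagram G1 G2) :=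
  RwhiskData {
  rd_ob : B;
  rd_p1 : hom rd_ob (sq_ob (sq F G1));
  rd_p2 : hom rd_ob (sq_ob (sq F G2));
  rd_h : hom rd_ob (dg_ob d);
  rd_lambda : icell (vbar (sq F G1) ∘ rd_p1) (vbar (sq F G2) ∘ rd_p2);
  rd_kappa1 : icell (fbar (sq F G1) ∘ rd_p1) (dg1 d ∘ rd_h);
  rd_kappa2 : icell (dg2 d ∘ rd_h) (fbar (sq F G2) ∘ rd_p2);
  rd_in : W ((leg F ∘ vbar (sq F G1)) ∘ rd_p1);
  rd_eq : awr (sq_cell (sq F G2)) rd_p2 • (leg G2 ◁ rd_kappa2)
      • awr (dgL d) rd_h • (leg G1 ◁ rd_kappa1)
    = (arr F ◁ rd_lambda) • awr (sq_cell (sq F G1)) rd_p1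
}.

Definition rwhisk_diagram (F : span W X Y) (G1 G2 : span W Y Z)
    (d : diagram G1 G2) (c : rwhisk_data F d) :
    diagram (span_comp sq F G1) (span_comp sq F G2) :=
  @Diagram B W X Z (span_comp sq F G1) (span_comp sq F G2)
    (rd_ob c) (rd_p1 c) (rd_p2 c)
    (iawl (leg F) (rd_lambda c))
    (asci (arr G2) (fbar (sq F G2)) (rd_p2 c)
       • (arr G2 ◁ rd_kappa2 c) • awr (dgR d) (rd_h c)
       • (arr G1 ◁ rd_kappa1 c)
       • asc (arr G1) (fbar (sq F G1)) (rd_p1 c))
    (rd_in c).

Definition rwhisk (F : span W X Y) (G1 G2 : span W Y Z)
    (Psi : diagram_set G1 G2) :
    diagram_set (span_comp sq F G1) (span_comp sq F G2) :=
  fun d => exists (d1 : diagram G1 G2) (c : rwhisk_data F d1),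
    Psi d1 /\ diagram_equiv (rwhisk_diagram c) d.

Arguments rwhisk F {G1 G2} Psi _.

Definition hcomp (H5 : WB5 W) (F1 F2 : span W X Y) (G1 G2 : span W Y Z)
    (Phi : diagram_set F1 F2) (Psi : diagram_set G1 G2) :
    diagram_set (span_comp sq F1 G1) (span_comp sq F2 G2) :=
  vcomp H5 (lwhisk Phi G1) (rwhisk F2 Psi).

End Whiskerings.

Section PullbackDiagrams.
Context (pp : pullback_choice W) (X Y : B) (F1 F2 : span W X Y).

Definition leg_pullback : pseudo_pullback (leg F1) (leg F2) :=
  pp (leg_in F1) (leg_in F2).

Lemma leg_pullback_in : WB5 W -> pullback_closed W ->
  W (leg F1 ∘ pp_pi1 leg_pullback).
Proof.
intros H5 Hpc. apply (H5 _ _ _ (leg F2 ∘ pp_pi2 leg_pullback)).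
- apply Hpc; apply leg_in.
- exact (pp_rho leg_pullback).
Qed.

Definition pullback_diagram (H5 : WB5 W) (Hpc : pullback_closed W)
    (beta : arr F1 ∘ pp_pi1 leg_pullback ⇒ arr F2 ∘ pp_pi2 leg_pullback) :
    diagram F1 F2 :=
  @Diagram B W X Y F1 F2 (pp_ob leg_pullback) (pp_pi1 leg_pullback)
    (pp_pi2 leg_pullback) (pp_rho leg_pullback) beta
    (leg_pullback_in H5 Hpc).

End PullbackDiagrams.

End TwoCells.

Arguments leg_pullback {B W} pp {X Y} F1 F2.
Arguments pullback_diagram {B W} pp {X Y F1 F2} H5 Hpc beta.
Arguments hcomp {B W} sq {X Y Z} H5 {F1 F2 G1 G2} Phi Psi _.

(* Main.v *)
Require Import Defs.

(** Whiskering by an arrow [w] of [W] is full and, after restriction along a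
    further arrow of [W], faithful.  Hence any two 2-cell diagrams between the same
    spans can be compared after restriction, in an essentially unique way that is
    forced by their left-hand 2-cells.  A 2-cell of fractions [(u1, f1) ⇒ (u2, f2)]
    therefore has, along every invertible [sigma : u1 a1 ⇒ u2 a2], a locally unique
    restriction to a 2-cell [theta : f1 a1 ⇒ f2 a2] of the bicategory.  Restrictions
    of whiskerings and of vertical composites are computed from those of their
    factors, whatever the representatives and the auxiliary choices.  Restrict the
    horizontal composite to a cover of the pseudo pullback [P] that also maps to the
    square for [f2] and [v1].  The whiskering of [beta] contributes [g1 t], where
    [t] lifts a conjugate of [beta wu] through [v1] and is invertible because [beta]
    is; the whiskering of [gamma] contributes [gamma wv] precomposed with the
    inverse of [g1 t].  Only [gamma wv] remains. *)

(** The rewriting of ssreflect unfolds [awr] when it looks for a vertical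
    composite; these tactics use the standard one, which leaves it alone once it
    is opaque. *)
Ltac rwall H := repeat rewrite H.
Ltac vcr := repeat rewrite <- vc_assoc.
Ltac vcl := rwall vc_assoc.

From Corelib Require Import ssreflect.

Set Implicit Arguments.
Unset Strict Implicit.
Unset Printing Implicit Defensive.

(** * Calculus of whiskerings *)

Section Calculus.
Context (B : bicategory).

Lemma vc_eq_r (X Y : B) (f g h k : hom X Y) (b : g ⇒ h) (a : f ⇒ g) (c : f ⇒ h) :
  b • a = c -> forall z : k ⇒ f, b • (a • z) = c • z.
Proof. by move=> <- z; rewrite vc_assoc. Qed.

Lemma asc_asci_r (X Y Z T : B) (h : hom Z T) (g : hom Y Z) (f : hom X Y) k
    (z : k ⇒ h ∘ (g ∘ f)) : asc h g f • (asci h g f • z) = z.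
Proof. by rewrite vc_assoc asc_asci vc_id_l. Qed.

Lemma asci_asc_r (X Y Z T : B) (h : hom Z T) (g : hom Y Z) (f : hom X Y) k
    (z : k ⇒ (h ∘ g) ∘ f) : asci h g f • (asc h g f • z) = z.
Proof. by rewrite vc_assoc asci_asc vc_id_l. Qed.

Lemma inv_icell_r (X Y : B) (f g k : hom X Y) (i : icell f g) (z : k ⇒ f) :
  icell_inv i • (i • z) = z.
Proof. by rewrite vc_assoc icell_invl vc_id_l. Qed.

Lemma icell_inv_r (X Y : B) (f g k : hom X Y) (i : icell f g) (z : k ⇒ g) :
  i • (icell_inv i • z) = z.
Proof. by rewrite vc_assoc icell_invr vc_id_l. Qed.

Lemma icell_cancel_l (X Y : B) (f g h : hom X Y) (i : icell g h) (a b : f ⇒ g) :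
  i • a = i • b -> a = b.
Proof. by move=> E; rewrite -(inv_icell_r i a) E inv_icell_r. Qed.

Lemma icell_cancel_r (X Y : B) (f g h : hom X Y) (i : icell f g) (a b : g ⇒ h) :
  a • i = b • i -> a = b.
Proof.
move=> E; rewrite -(vc_id_r a) -(icell_invr i) vc_assoc E -vc_assoc.
by rewrite icell_invr vc_id_r.
Qed.

Definition iinv (X Y : B) (f g : hom X Y) (i : icell f g) : icell g f :=
  ICell (icell_invr i) (icell_invl i).

Lemma awr_vc (X Y Y' Y'' Z T : B) (f : hom Y Z) (u : hom X Y) (g : hom Y' Z)
    (v : hom X Y') (h : hom Y'' Z) (w : hom X Y'') (b : g ∘ v ⇒ h ∘ w)
    (a : f ∘ u ⇒ g ∘ v) (s : hom T X) : awr (b • a) s = awr b s • awr a s.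
Proof. by rewrite /awr rw_vc -!vc_assoc asci_asc_r. Qed.

Lemma awr_lw (X Y Z T : B) (k : hom Y Z) (f g : hom X Y) (e : f ⇒ g)
    (s : hom T X) : awr (k ◁ e) s = k ◁ (e ▷ s).
Proof. by rewrite /awr asc_nat_m -vc_assoc asc_asci vc_id_r. Qed.

(** Interchange, with the associators moved out of the way by naturality. *)
Lemma awr_nat (X Y Y' Z T : B) (f : hom Y Z) (u : hom X Y) (g : hom Y' Z)
    (v : hom X Y') (b : f ∘ u ⇒ g ∘ v) (s s' : hom T X) (t : s ⇒ s') :
  (g ◁ (v ◁ t)) • awr b s = awr b s' • (f ◁ (u ◁ t)).
Proof.
have E : asci f u s' • (f ◁ (u ◁ t)) = ((f ∘ u) ◁ t) • asci f u s.
  rewrite -[LHS]vc_id_r -(asc_asci f u s) vc_assoc -(vc_assoc (asci _ _ _)).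
  by rewrite -asc_nat_r vc_assoc asci_asc vc_id_l.
rewrite /awr -!vc_assoc E !vc_assoc -asc_nat_r -(vc_assoc (asc g v s')).
by rewrite -interchange !vc_assoc.
Qed.

(** The pentagon solved for the restricted associator. With its inverse form [awr_asci] it makes
    iterated restriction coherent, as in [awr3_awr]. *)
Lemma pentagon_awr (X1 X2 X3 X4 X5 : B) (k : hom X4 X5) (h : hom X3 X4)
    (g : hom X2 X3) (f : hom X1 X2) :
  awr (asc k h g) f = (k ◁ asci h g f) • asc k h (g ∘ f).
Proof.

apply: (@icell_cancel_l _ _ _ _ _ (ilw k (iasc h g f))) => /=.
rewrite -[RHS]vc_id_r vc_assoc -lw_vc asc_asci lw_id vc_id_l.
apply: (@icell_cancel_r _ _ _ _ _ (iasc (k ∘ h) g f)) => /=.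
by rewrite vc_id_r pentagon /awr -!vc_assoc asci_asc vc_id_r.
Qed.

Lemma awr_asci (X1 X2 X3 X4 X5 : B) (k : hom X4 X5) (h : hom X3 X4)
    (g : hom X2 X3) (f : hom X1 X2) :
  awr (asci k h g) f = asci k h (g ∘ f) • (k ◁ asc h g f).
Proof.
apply: (@icell_cancel_l _ _ _ _ _ (iawr (iasc k h g) f)) => /=.
rewrite -/(awr (asc k h g) f) -awr_vc asc_asci pentagon_awr -!vc_assoc.
rewrite asc_asci_r -lw_vc.
by rewrite asci_asc lw_id /awr rw_id vc_id_r asc_asci.
Qed.

Lemma rw_awr (X Y Y' Z T : B) (f : hom Y Z) (u : hom X Y) (g : hom Y' Z)
    (v : hom X Y') (b : f ∘ u ⇒ g ∘ v) (s : hom T X) :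
  b ▷ s = asci g v s • awr b s • asc f u s.
Proof. by rewrite /awr -!vc_assoc asci_asc_r asci_asc vc_id_r. Qed.

Lemma awr_rw (X Y Z T : B) (f g : hom Z T) (a : f ⇒ g) (u : hom Y Z)
    (s : hom X Y) : awr (a ▷ u) s = a ▷ (u ∘ s).
Proof. by rewrite /awr asc_nat_l -vc_assoc asc_asci vc_id_r. Qed.

Lemma iawrE (X Y Y' Z T : B) (f : hom Y Z) (u : hom X Y) (g : hom Y' Z)
    (v : hom X Y') (b : icell (f ∘ u) (g ∘ v)) (s : hom T X) :
  icell_cell (iawr b s) = awr b s.
Proof. by []. Qed.

Lemma iawr_invE (X Y Y' Z T : B) (f : hom Y Z) (u : hom X Y) (g : hom Y' Z)
    (v : hom X Y') (b : icell (f ∘ u) (g ∘ v)) (s : hom T X) :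
  icell_inv (iawr b s) = awr (icell_inv b) s.
Proof. by rewrite /awr /= vc_assoc. Qed.

Lemma awrE (X Y Y' Z T : B) (f : hom Y Z) (u : hom X Y) (g : hom Y' Z)
    (v : hom X Y') (b : f ∘ u ⇒ g ∘ v) (s : hom T X) :
  awr b s = asc g v s • (b ▷ s) • asci f u s.
Proof. by []. Qed.

Opaque awr.

Lemma lw_comp (X Y Z T : B) (k : hom Z T) (h : hom Y Z) (f g : hom X Y)
    (a : f ⇒ g) : (k ∘ h) ◁ a = asci k h g • (k ◁ (h ◁ a)) • asc k h f.
Proof. by rewrite -vc_assoc -asc_nat_r asci_asc_r. Qed.

Lemma lw_asci_asc (X Y Z T U : B) (k : hom T U) (h : hom Z T) (g : hom Y Z)
    (f : hom X Y) : (k ◁ asci h g f) • (k ◁ asc h g f) = id2 _.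
Proof. by rewrite -lw_vc asci_asc lw_id. Qed.

Lemma lw_asc_asci (X Y Z T U : B) (k : hom T U) (h : hom Z T) (g : hom Y Z)
    (f : hom X Y) : (k ◁ asc h g f) • (k ◁ asci h g f) = id2 _.
Proof. by rewrite -lw_vc asc_asci lw_id. Qed.

Lemma lw_asci_asc_r (X Y Z T U : B) (k : hom T U) (h : hom Z T) (g : hom Y Z)
    (f : hom X Y) l (z : l ⇒ _) : (k ◁ asci h g f) • ((k ◁ asc h g f) • z) = z.
Proof. by rewrite vc_assoc lw_asci_asc vc_id_l. Qed.

Lemma lw_asc_asci_r (X Y Z T U : B) (k : hom T U) (h : hom Z T) (g : hom Y Z)
    (f : hom X Y) l (z : l ⇒ _) : (k ◁ asc h g f) • ((k ◁ asci h g f) • z) = z.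
Proof. by rewrite vc_assoc lw_asc_asci vc_id_l. Qed.

(** Like [awr], for composites of three arrows: with every composite bracketed to
    the right, restricting twice involves no associativity constraint. *)
Definition awr3 (X Y Y' Z Z' V T : B)
    (f : hom Z V) (u : hom Y Z) (x : hom X Y)
    (g : hom Z' V) (v : hom Y' Z') (y : hom X Y')
    (b : f ∘ (u ∘ x) ⇒ g ∘ (v ∘ y)) (s : hom T X) :
    f ∘ (u ∘ (x ∘ s)) ⇒ g ∘ (v ∘ (y ∘ s)) :=
  (g ◁ asc v y s) • awr b s • (f ◁ asci u x s).

Lemma awr3E (X Y Y' Z Z' V T : B)
    (f : hom Z V) (u : hom Y Z) (x : hom X Y)
    (g : hom Z' V) (v : hom Y' Z') (y : hom X Y')
    (b : f ∘ (u ∘ x) ⇒ g ∘ (v ∘ y)) (s : hom T X) :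
  awr3 b s = (g ◁ asc v y s) • awr b s • (f ◁ asci u x s).
Proof. by []. Qed.

Lemma awr_awr3 (X Y Y' Z Z' V T : B)
    (f : hom Z V) (u : hom Y Z) (x : hom X Y)
    (g : hom Z' V) (v : hom Y' Z') (y : hom X Y')
    (b : f ∘ (u ∘ x) ⇒ g ∘ (v ∘ y)) (s : hom T X) :
  awr b s = (g ◁ asci v y s) • awr3 b s • (f ◁ asc u x s).
Proof.
by rewrite /awr3; vcr; rewrite lw_asci_asc_r lw_asci_asc vc_id_r.
Qed.

Lemma awr3_vc (X Y Y' Y'' Z Z' Z'' V T : B)
    (f : hom Z V) (u : hom Y Z) (x : hom X Y)
    (g : hom Z' V) (v : hom Y' Z') (y : hom X Y')
    (h : hom Z'' V) (w : hom Y'' Z'') (z : hom X Y'')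
    (b : g ∘ (v ∘ y) ⇒ h ∘ (w ∘ z))
    (a : f ∘ (u ∘ x) ⇒ g ∘ (v ∘ y)) (s : hom T X) :
  awr3 (b • a) s = awr3 b s • awr3 a s.
Proof. by rewrite /awr3 awr_vc; vcr; rewrite lw_asci_asc_r. Qed.

Lemma awr3_lw (X Y Y' Z V T : B) (k : hom Z V)
    (u : hom Y Z) (x : hom X Y) (v : hom Y' Z) (y : hom X Y')
    (e : u ∘ x ⇒ v ∘ y) (s : hom T X) :
  awr3 (k ◁ e) s = k ◁ awr e s.
Proof. by rewrite /awr3 awr_lw rw_awr !lw_vc; vcr; rewrite lw_asc_asci_r
  lw_asc_asci vc_id_r. Qed.

Lemma awr3_awr (X Y Y' Z T U : B) (f : hom Y Z) (u : hom X Y)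
    (g : hom Y' Z) (v : hom X Y') (b : f ∘ u ⇒ g ∘ v) (s : hom T X)
    (r : hom U T) : awr3 (awr b s) r = awr b (s ∘ r).
Proof.
rewrite /awr3 (awrE b s) 2!awr_vc pentagon_awr awr_asci awr_rw.
by vcr; rewrite lw_asc_asci_r lw_asc_asci vc_id_r (awrE b); vcr.
Qed.

(** Legs of composite spans are bracketed to the left; conjugation by associators brings them to the
    form that [awr3] restricts, and commutes with restriction. *)
Lemma awr3_conj (X Y Y' Z Z' V T : B)
    (f : hom Z V) (u : hom Y Z) (x : hom X Y)
    (g : hom Z' V) (v : hom Y' Z') (y : hom X Y')
    (b : (f ∘ u) ∘ x ⇒ (g ∘ v) ∘ y) (s : hom T X) :
  awr3 (asc g v y • b • asci f u x) s
  = asc g v (y ∘ s) • awr b s • asci f u (x ∘ s).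
Proof.
rewrite /awr3 !awr_vc pentagon_awr awr_asci; vcr; rewrite lw_asc_asci_r.
by rewrite lw_asc_asci vc_id_r.
Qed.

Lemma awr_awl (X Y Y' Z T U : B) (h : hom Z U) (f : hom Y Z) (u : hom X Y)
    (g : hom Y' Z) (v : hom X Y') (b : f ∘ u ⇒ g ∘ v) (s : hom T X) :
  awr (awl h b) s = awl h (awr b s).
Proof.
rewrite /awl !awr_vc awr_asci pentagon_awr awr_lw rw_awr !lw_vc; vcr.
by rewrite !lw_asc_asci_r.
Qed.

Lemma asc_awl_asci (X Y Y' Z T : B) (h : hom Z T) (f : hom Y Z) (u : hom X Y)
    (g : hom Y' Z) (v : hom X Y') (b : f ∘ u ⇒ g ∘ v) :
  asc h g v • awl h b • asci h f u = h ◁ b.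
Proof. by rewrite /awl; vcr; rewrite asc_asci_r asc_asci vc_id_r. Qed.

Lemma awl_inj (X Y Y' Z T : B) (h : hom Z T) (f : hom Y Z) (u : hom X Y)
    (g : hom Y' Z) (v : hom X Y') (b b' : f ∘ u ⇒ g ∘ v) :
  awl h b = awl h b' -> h ◁ b = h ◁ b'.
Proof.
move=> E; apply: (@icell_cancel_l _ _ _ _ _ (iasci h g v)).
exact: (@icell_cancel_r _ _ _ _ _ (iasc h f u)).
Qed.

Lemma awr3_icell (X Y Y' Z Z' V T : B)
    (f : hom Z V) (u : hom Y Z) (x : hom X Y)
    (g : hom Z' V) (v : hom Y' Z') (y : hom X Y')
    (b : icell (f ∘ (u ∘ x)) (g ∘ (v ∘ y))) (s : hom T X) :
  exists i : icell (f ∘ (u ∘ (x ∘ s))) (g ∘ (v ∘ (y ∘ s))),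
    icell_cell i = awr3 b s.
Proof.
by exists (ivc (ivc (ilw g (iasc v y s)) (iawr b s)) (ilw f (iasci u x s))).
Qed.

Lemma awr_id2 (X Y Z T : B) (f : hom Y Z) (u : hom X Y) (s : hom T X) :
  awr (id2 (f ∘ u)) s = id2 _.
Proof. by rewrite awrE rw_id vc_id_r asc_asci. Qed.

Lemma awr_invl (X Y Y' Z T : B) (f : hom Y Z) (u : hom X Y)
    (g : hom Y' Z) (v : hom X Y') (i : icell (f ∘ u) (g ∘ v)) (s : hom T X) :
  awr (icell_inv i) s • awr i s = id2 _.
Proof. by rewrite -awr_vc icell_invl awr_id2. Qed.

Lemma awr_invr (X Y Y' Z T : B) (f : hom Y Z) (u : hom X Y)
    (g : hom Y' Z) (v : hom X Y') (i : icell (f ∘ u) (g ∘ v)) (s : hom T X) :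
  awr i s • awr (icell_inv i) s = id2 _.
Proof. by rewrite -awr_vc icell_invr awr_id2. Qed.

End Calculus.

(** * Covers *)

Section Covers.
Context (B : bicategory) (W : arrow_class B) (HW : WBconditions W).

(** Covers are closed under composition, unlike the arrows of [W]. *)
Definition covers (X Y : B) (n : hom X Y) : Prop :=
  exists (T : B) (y : hom T X), W (n ∘ y).

Lemma W_iso (X Y : B) (f g : hom X Y) : icell f g -> W g -> W f.
Proof. by move=> i Hg; apply: (wb5 HW Hg i). Qed.

Lemma W_covers (X Y : B) (n : hom X Y) : W n -> covers n.
Proof.
move=> Hn; exists X, (id1 X); apply: W_iso Hn.
exact: (ICell (runi_run n) (run_runi n)).
Qed.

(** [WB3] applies to [n ∘ y] in [W]; the factor [y] is then absorbed into [h]. *)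
Lemma covers_pull (X Y Z : B) (n : hom X Y) (f : hom Z Y) : covers n ->
  exists (T : B) (v : hom T Z) (h : hom T X),
    covers v /\ inhabited (icell (n ∘ h) (f ∘ v)).
Proof.
move=> [D [y Hy]]; have [T [h [v [Hv [i]]]]] := wb3 HW f Hy.
exists T, v, (y ∘ h); split; first exact: W_covers.
by constructor; apply: ivc i (iasci _ _ _).
Qed.

Lemma W_comp_covers (X Y Z : B) (w : hom Y Z) (n : hom X Y) :
  W w -> covers n -> covers (w ∘ n).
Proof.
move=> Hw [T [y Hy]]; have [U [u Hu]] := wb2 HW Hy Hw.
exists U, (y ∘ u); apply: W_iso Hu.
exact: ivc (ilw w (iasci _ _ _)) (iasc _ _ _).
Qed.

(** Pulling [n] back along an arrow [y] with [m ∘ y] in [W] makes [y] factor through [n] on a cover;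
    [WB2] then provides a further restriction that lands in [W]. *)
Lemma covers_comp (X Y Z : B) (m : hom Y Z) (n : hom X Y) :
  covers m -> covers n -> covers (m ∘ n).
Proof.
move=> [T [y Hy]] Hn.
have [U [v [h [Hv [i]]]]] := covers_pull y Hn.
have [V [z Hz]] := W_comp_covers Hy Hv.
exists V, (h ∘ z); apply: W_iso Hz.
refine (ivc (iasci _ _ _) (ivc (iasci _ _ _) (ivc (ilw m _) (iasc _ _ _)))).
exact: ivc (iasc _ _ _) (ivc (irw i z) (iasci _ _ _)).
Qed.

(** The restrictions of [a] and [b] along an identity lift the same 2-cell, so the uniqueness clause
    of [WB4] compares them; interchange cancels the invertible comparison. *)
Lemma faithful_on_cover (X Y Z : B) (w : hom Y Z) (f g : hom X Y) (a b : f ⇒ g) :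
  W w -> w ◁ a = w ◁ b -> exists (T : B) (n : hom T X), covers n /\ a ▷ n = b ▷ n.
Proof.
move=> Hw E.
have [_ U] := wb4 HW (w ◁ a) Hw.
have La : lifting W (w ◁ a) (a ▷ id1 X).
  by split; [exact: (wb1 HW) | rewrite awr_lw].
have Lb : lifting W (w ◁ a) (b ▷ id1 X).
  by split; [exact: (wb1 HW) | rewrite E awr_lw].
have [T [s [t [e [Hs [_ Es]]]]]] := U _ _ _ _ _ _ La Lb.
exists T, (id1 X ∘ s); split; first exact: W_covers.
apply: (@icell_cancel_l _ _ _ _ _ _ (ilw g e)) => /=.
by move: Es; rewrite !awr_rw interchange.
Qed.

Lemma faithful_on_cover_awr (X Y Y' Z T : B) (w : hom Z T)
    (f : hom Y Z) (u : hom X Y) (g : hom Y' Z) (v : hom X Y')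
    (a b : f ∘ u ⇒ g ∘ v) :
  W w -> w ◁ a = w ◁ b ->
  exists (U : B) (n : hom U X), covers n /\ awr a n = awr b n.
Proof.
move=> Hw E; have [U [n [Hn En]]] := faithful_on_cover Hw E.
by exists U, n; split=> //; rewrite !awrE En.
Qed.

Lemma faithful_on_cover_awr3 (X Y Y' Z Z' V T : B) (w : hom V T)
    (f : hom Z V) (u : hom Y Z) (x : hom X Y)
    (g : hom Z' V) (v : hom Y' Z') (y : hom X Y')
    (a b : f ∘ (u ∘ x) ⇒ g ∘ (v ∘ y)) :
  W w -> w ◁ a = w ◁ b ->
  exists (U : B) (n : hom U X), covers n /\ awr3 a n = awr3 b n.
Proof.
move=> Hw E; have [U [n [Hn En]]] := faithful_on_cover_awr Hw E.
by exists U, n; split=> //; rewrite !awr3E En.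
Qed.

Context (Hfull : forall (X Y : B) (w : hom X Y), W w -> full w).

(** Fullness lifts [i] and its inverse separately; local faithfulness makes the two lifts mutually
    inverse after one restriction for each composite. *)
Lemma lift_icell_rw (X Y Z : B) (w : hom Y Z) (f g : hom X Y)
    (i : icell (w ∘ f) (w ∘ g)) : W w ->
  exists (U : B) (n : hom U X) (j : icell (f ∘ n) (g ∘ n)),
    covers n /\ w ◁ j = awr i n.
Proof.
move=> Hw.
have [a Ea] := Hfull Hw i; have [b Eb] := Hfull Hw (icell_inv i).
have E1 : w ◁ (b • a) = w ◁ id2 _ by rewrite lw_vc Ea Eb icell_invl lw_id.
have E2 : w ◁ (a • b) = w ◁ id2 _ by rewrite lw_vc Ea Eb icell_invr lw_id.
have [U1 [n1 [H1 {}E1]]] := faithful_on_cover Hw E1.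
(* The second cover is taken over the first, so that both identities hold on [n1 ∘ n2]. *)
have {}E2 : w ◁ ((a • b) ▷ n1) = w ◁ (id2 _ ▷ n1) by rewrite -!awr_lw E2.
have [U2 [n2 [H2 {}E2]]] := faithful_on_cover Hw E2.
have F1 : (b ▷ (n1 ∘ n2)) • (a ▷ (n1 ∘ n2)) = id2 _.
  by rewrite -rw_vc -awr_rw E1 awr_rw rw_id.
have F2 : (a ▷ (n1 ∘ n2)) • (b ▷ (n1 ∘ n2)) = id2 _.
  by rewrite -rw_vc -awr_rw awrE E2 -awrE awr_rw rw_id.
exists U2, (n1 ∘ n2), (ICell F1 F2); split; first exact: covers_comp.
by rewrite /= -awr_lw Ea.
Qed.

Lemma lift_icell (X Y Y' Z T : B) (w : hom Z T)
    (f : hom Y Z) (u : hom X Y) (g : hom Y' Z) (v : hom X Y')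
    (i : icell (w ∘ (f ∘ u)) (w ∘ (g ∘ v))) : W w ->
  exists (U : B) (n : hom U X) (j : icell (f ∘ (u ∘ n)) (g ∘ (v ∘ n))),
    covers n /\ w ◁ j = awr3 i n.
Proof.
move=> Hw; have [U [n [j [Hn Ej]]]] := lift_icell_rw i Hw.
exists U, n, (ivc (ivc (iasc g v n) j) (iasci f u n)); split=> //=.
by rewrite !lw_vc Ej awr3E.
Qed.

(** [WB3] compares [w ∘ n ∘ k] with [w ∘ v] for some [v] in [W]; lifting through [w] identifies
    [n ∘ k] with [v] on a cover. *)
Lemma covers_right_factor (X Y Z : B) (w : hom Y Z) (n : hom X Y) :
  W w -> W (w ∘ n) -> covers n.
Proof.
move=> Hw Hn; have [T [k [v [Hv [i]]]]] := wb3 HW w Hn.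
have [U [y [j [Hy _]]]] := lift_icell_rw (ivc i (iasci w n k)) Hw.
have [V [z Hz]] := W_comp_covers Hv Hy.
exists V, (k ∘ (y ∘ z)); apply: W_iso Hz.
refine (ivc (irw j z) (ivc (iasci _ _ _) (iasci _ _ _))).
Qed.

End Covers.

(** * Restriction of 2-cells of fractions *)

Section Intertwining.
Context (B : bicategory).

(** Both equations in the equivalence of 2-cell diagrams have this form, one for the left-hand and
    one for the right-hand 2-cells, with the same [e1] and [e2]. *)
Definition intertwines (C1 C2 D T N Y : B) (f1 : hom C1 Y) (f2 : hom C2 Y)
    (s1 : hom D C1) (s2 : hom D C2) (b : f1 ∘ s1 ⇒ f2 ∘ s2) (m : hom N D)
    (a1 : hom T C1) (a2 : hom T C2) (t : f1 ∘ a1 ⇒ f2 ∘ a2) (n : hom N T)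
    (e1 : s1 ∘ m ⇒ a1 ∘ n) (e2 : s2 ∘ m ⇒ a2 ∘ n) : Prop :=
  (f2 ◁ e2) • awr b m = awr t n • (f1 ◁ e1).

Context (C1 C2 Y : B) (f1 : hom C1 Y) (f2 : hom C2 Y).

Lemma intertwines_awr (D T N N' : B) (s1 : hom D C1) (s2 : hom D C2)
    (b : f1 ∘ s1 ⇒ f2 ∘ s2) (m : hom N D) (a1 : hom T C1) (a2 : hom T C2)
    (t : f1 ∘ a1 ⇒ f2 ∘ a2) (n : hom N T)
    (e1 : s1 ∘ m ⇒ a1 ∘ n) (e2 : s2 ∘ m ⇒ a2 ∘ n) (r : hom N' N) :
  intertwines b t e1 e2 ->
  intertwines b t (awr e1 r) (awr e2 r).
Proof.
move=> E; have: awr3 ((f2 ◁ e2) • awr b m) r = awr3 (awr t n • (f1 ◁ e1)) r.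
  by rewrite E.
by rewrite !awr3_vc !awr3_lw !awr3_awr.
Qed.

Lemma intertwines_vc (D D' T N : B) (s1 : hom D C1) (s2 : hom D C2)
    (b : f1 ∘ s1 ⇒ f2 ∘ s2) (m : hom N D)
    (s1' : hom D' C1) (s2' : hom D' C2) (b' : f1 ∘ s1' ⇒ f2 ∘ s2') (m' : hom N D')
    (a1 : hom T C1) (a2 : hom T C2)
    (t : f1 ∘ a1 ⇒ f2 ∘ a2) (n : hom N T)
    (e1 : s1 ∘ m ⇒ s1' ∘ m') (e2 : s2 ∘ m ⇒ s2' ∘ m')
    (e1' : s1' ∘ m' ⇒ a1 ∘ n) (e2' : s2' ∘ m' ⇒ a2 ∘ n) :
  intertwines b b' e1 e2 -> intertwines b' t e1' e2' ->
  intertwines b t (e1' • e1) (e2' • e2).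
Proof.
rewrite /intertwines !lw_vc => E E'.
by vcr; rewrite E vc_assoc E'; vcr.
Qed.

Lemma intertwines_lw (D N : B) (s1 : hom D C1) (s2 : hom D C2)
    (b : f1 ∘ s1 ⇒ f2 ∘ s2) (m m' : hom N D) (r : m ⇒ m') :
  intertwines b b (s1 ◁ r) (s2 ◁ r).
Proof. exact: awr_nat. Qed.

Lemma intertwines_awr_comp (D T N N' N'' : B) (s1 : hom D C1) (s2 : hom D C2)
    (b : f1 ∘ s1 ⇒ f2 ∘ s2) (m : hom N D) (a1 : hom T C1) (a2 : hom T C2)
    (t : f1 ∘ a1 ⇒ f2 ∘ a2) (n : hom N T)
    (e1 : s1 ∘ m ⇒ a1 ∘ n) (e2 : s2 ∘ m ⇒ a2 ∘ n)
    (y : hom N' N) (z : hom N'' N') :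
  intertwines b t (awr (awr e1 y) z) (awr (awr e2 y) z) ->
  intertwines b t (awr e1 (y ∘ z)) (awr e2 (y ∘ z)).
Proof.
rewrite -!(awr3_awr (u := m)) !awr3E => E.
apply: (intertwines_vc (b' := b)); first exact: intertwines_lw.
by apply: (intertwines_vc (b' := t)); last exact: intertwines_lw.
Qed.

Lemma intertwines_inv (D T N : B) (s1 : hom D C1) (s2 : hom D C2)
    (b : f1 ∘ s1 ⇒ f2 ∘ s2) (m : hom N D) (a1 : hom T C1) (a2 : hom T C2)
    (t : f1 ∘ a1 ⇒ f2 ∘ a2) (n : hom N T)
    (e1 : icell (s1 ∘ m) (a1 ∘ n)) (e2 : icell (s2 ∘ m) (a2 ∘ n)) :
  intertwines b t e1 e2 -> intertwines t b (icell_inv e1) (icell_inv e2).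
Proof.
rewrite /intertwines => E.
apply: (@icell_cancel_l _ _ _ _ _ _ (ilw f2 e2)) => /=.
vcl; rewrite E -lw_vc icell_invr lw_id vc_id_l.
by vcr; rewrite -lw_vc icell_invr lw_id vc_id_r.
Qed.

End Intertwining.

Section Agreement.
Context (B : bicategory) (W : arrow_class B) (HW : WBconditions W).
Context (X Y : B) (F1 F2 : span W X Y).

(** The 2-cell of fractions represented by [d] restricts along [sigma], locally
    on [T], to the 2-cell [theta] of the bicategory. *)
Definition agrees (d : diagram F1 F2) (T : B)
    (a1 : hom T (apex F1)) (a2 : hom T (apex F2))
    (sigma : leg F1 ∘ a1 ⇒ leg F2 ∘ a2) (theta : arr F1 ∘ a1 ⇒ arr F2 ∘ a2) :
    Prop :=
  exists (N : B) (n : hom N T) (m : hom N (dg_ob d))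
    (e1 : icell (dg1 d ∘ m) (a1 ∘ n)) (e2 : icell (dg2 d ∘ m) (a2 ∘ n)),
    covers W n /\
    intertwines (dgL d) sigma e1 e2 /\ intertwines (dgR d) theta e1 e2.

Definition agrees_diagram (d d' : diagram F1 F2) : Prop :=
  agrees d (dgL d') (dgR d').

(** When the comparison arrow [m] is defined on all of [T], the identity serves as the cover. *)
Lemma agrees_restrict (d : diagram F1 F2) (T : B)
    (a1 : hom T (apex F1)) (a2 : hom T (apex F2))
    (sigma : leg F1 ∘ a1 ⇒ leg F2 ∘ a2) (theta : arr F1 ∘ a1 ⇒ arr F2 ∘ a2)
    (m : hom T (dg_ob d)) (e1 : icell (dg1 d ∘ m) a1) (e2 : icell (dg2 d ∘ m) a2) :
  (leg F2 ◁ e2) • awr (dgL d) m = sigma • (leg F1 ◁ e1) ->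
  (arr F2 ◁ e2) • awr (dgR d) m = theta • (arr F1 ◁ e1) ->
  agrees d sigma theta.
Proof.
move=> EL ER; exists T, (id1 T), (m ∘ id1 T).
exists (ivc (irw e1 (id1 T)) (iasci _ _ _)), (ivc (irw e2 (id1 T)) (iasci _ _ _)).
have P (C1 C2 Q : B) (f1 : hom C1 Q) (f2 : hom C2 Q) s1 s2 (b : f1 ∘ s1 ⇒ f2 ∘ s2)
    (t1 : hom T C1) (t2 : hom T C2) (t : f1 ∘ t1 ⇒ f2 ∘ t2)
    (i1 : s1 ∘ m ⇒ t1) (i2 : s2 ∘ m ⇒ t2) :
    (f2 ◁ i2) • awr b m = t • (f1 ◁ i1) ->
    intertwines b t ((i1 ▷ id1 T) • asci s1 m (id1 T))
                    ((i2 ▷ id1 T) • asci s2 m (id1 T)).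
  move=> E; rewrite /intertwines !lw_vc.
  have: awr ((f2 ◁ i2) • awr b m) (id1 T) = awr (t • (f1 ◁ i1)) (id1 T) by rewrite E.
  rewrite (awr_vc (f2 ◁ i2)) (awr_vc t) !awr_lw (awr_awr3 (awr b m)) awr3_awr => {}E.
  apply: (@icell_cancel_r _ _ _ _ _ _ (ilw f1 (iasc s1 m (id1 T)))) => /=.
  by move: E; vcr; rewrite lw_asci_asc vc_id_r.
by split; [exact/W_covers/(wb1 HW) | split; apply: P].
Qed.

(** The cover of the apex of [d'] on which [d] and [d'] agree is pulled back along [m'], and the two
    comparisons are pasted there. *)
Lemma agrees_trans (d d' : diagram F1 F2) (T : B)
    (a1 : hom T (apex F1)) (a2 : hom T (apex F2))
    (sigma : leg F1 ∘ a1 ⇒ leg F2 ∘ a2) (theta : arr F1 ∘ a1 ⇒ arr F2 ∘ a2) :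
  agrees_diagram d d' -> agrees d' sigma theta -> agrees d sigma theta.
Proof.
move=> [N [n [m [e1 [e2 [Hn [EL ER]]]]]]] [N' [n' [m' [e1' [e2' [Hn' [EL' ER']]]]]]].
have [U [y' [y [Hy [i]]]]] := covers_pull HW m' Hn.
exists U, (n' ∘ y'), (m ∘ y).
exists (ivc (iawr e1' y') (ivc (ilw (dg1 d') i) (iawr e1 y))).
exists (ivc (iawr e2' y') (ivc (ilw (dg2 d') i) (iawr e2 y))).
split; first exact: covers_comp.
split.
  apply: (intertwines_vc (b' := dgL d')); last exact: intertwines_awr EL'.
  by apply: intertwines_vc; [exact: intertwines_awr EL | exact: intertwines_lw].
apply: (intertwines_vc (b' := dgR d')); last exact: intertwines_awr ER'.
by apply: intertwines_vc; [exact: intertwines_awr ER | exact: intertwines_lw].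
Qed.

Lemma agrees_local (d : diagram F1 F2) (T U : B) (x : hom U T)
    (a1 : hom T (apex F1)) (a2 : hom T (apex F2))
    (sigma : leg F1 ∘ a1 ⇒ leg F2 ∘ a2) (theta : arr F1 ∘ a1 ⇒ arr F2 ∘ a2) :
  covers W x -> agrees d (awr sigma x) (awr theta x) -> agrees d sigma theta.
Proof.
move=> Hx [N [n [m [e1 [e2 [Hn [EL ER]]]]]]].
exists N, (x ∘ n), m, (ivc (iasc _ _ _) e1), (ivc (iasc _ _ _) e2).
split; first exact: covers_comp.
by split; [move: EL | move: ER]; rewrite /intertwines /= !lw_vc awr_awr3 awr3_awr;
  vcr; move=> ->; vcr; rewrite lw_asc_asci_r.
Qed.

Context (Hfull : forall (X Y : B) (w : hom X Y), W w -> full w).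

(** The two relations differ in what they ask of the common refinement: a composite in [W], or a
    cover. [covers_right_factor] cancels the leg in one direction; a further restriction returns to
    [W] in the other. *)
Lemma diagram_equiv_agrees (d d' : diagram F1 F2) :
  diagram_equiv d d' <-> agrees_diagram d d'.
Proof.
split=> [[T [p [q [e1 [e2 [Hp [EL ER]]]]]]] | [T [q [p [e1 [e2 [Hq [EL ER]]]]]]]].
  exists T, q, p, e1, e2; split=> //.
  apply: (covers_right_factor HW Hfull (dg_in d')).
  apply: W_iso HW _ _ _ _ _ Hp.
  exact: ivc (ilw _ (iinv e1)) (iasc _ _ _).
have [U [y Hy]] := W_comp_covers HW (dg_in d') Hq.
exists U, (p ∘ y), (q ∘ y), (iawr e1 y), (iawr e2 y); split.
  apply: W_iso HW _ _ _ _ _ Hy.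
  refine (ivc _ (ilw _ (iawr e1 y))).
  exact: ivc (iasci _ _ _) (iasci _ _ _).
by rewrite !iawrE; split; apply: intertwines_awr.
Qed.

Lemma diagram_equiv_refl (d : diagram F1 F2) : diagram_equiv d d.
Proof.
have [T [y Hy]] := W_covers HW (dg_in d).
pose i1 := ICell (vc_id_l (id2 (dg1 d ∘ y))) (vc_id_l _).
pose i2 := ICell (vc_id_l (id2 (dg2 d ∘ y))) (vc_id_l _).
exists T, y, y, i1, i2; split; first exact: W_iso HW _ _ _ _ (iasci _ _ _) Hy.
by rewrite /= !lw_id !vc_id_l !vc_id_r.
Qed.

Lemma diagram_equiv_sym (d d' : diagram F1 F2) :
  diagram_equiv d d' -> diagram_equiv d' d.
Proof.
move=> [T [p [q [e1 [e2 [Hp [EL ER]]]]]]].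
exists T, q, p, (iinv e1), (iinv e2); split.
  by apply: W_iso HW _ _ _ _ _ Hp; exact: ilw _ (iinv e1).
by split; apply: intertwines_inv.
Qed.

Lemma diagram_equiv_trans (d d' d'' : diagram F1 F2) :
  diagram_equiv d d' -> diagram_equiv d' d'' -> diagram_equiv d d''.
Proof.
move=> /diagram_equiv_agrees A /diagram_equiv_agrees A'.
by apply/diagram_equiv_agrees; exact: agrees_trans A A'.
Qed.

(** As [a] is invertible, the equation prescribes [leg F2 ◁ e2] once [e1] is given; the prescribed
    2-cell lifts through [leg F2] on a cover. *)
Lemma intertwines_lift (D T N : B) (s1 : hom D (apex F1)) (s2 : hom D (apex F2))
    (a : icell (leg F1 ∘ s1) (leg F2 ∘ s2)) (m : hom N D)
    (a1 : hom T (apex F1)) (a2 : hom T (apex F2))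
    (sigma : icell (leg F1 ∘ a1) (leg F2 ∘ a2)) (n : hom N T)
    (e1 : icell (s1 ∘ m) (a1 ∘ n)) :
  exists (U : B) (y : hom U N) (e2 : icell (s2 ∘ (m ∘ y)) (a2 ∘ (n ∘ y))),
    covers W y /\ intertwines a sigma (awr e1 y) e2.
Proof.
pose i := ivc (ivc (iawr sigma n) (ilw (leg F1) e1)) (iinv (iawr a m)).
have [U [y [e2 [Hy E]]]] := lift_icell HW Hfull i (leg_in F2).
exists U, y, e2; split=> //.
have Ei : i • awr a m = awr sigma n • (leg F1 ◁ e1).
  have -> : icell_cell i
      = awr sigma n • (leg F1 ◁ e1) • icell_inv (iawr a m) by [].
  by rewrite -(iawrE a) -[LHS]vc_assoc icell_invl vc_id_r.
by rewrite /intertwines E -(awr3_awr a) -awr3_vc Ei awr3_vc awr3_lw awr3_awr.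
Qed.

(** [WB3] pulls [leg F1 ∘ dg1 d] back along [leg F1 ∘ a1]; lifting the square through [leg F1] gives
    [e1], from which [e2] is lifted. *)
Lemma agrees_exists (d : diagram F1 F2) (T : B)
    (a1 : hom T (apex F1)) (a2 : hom T (apex F2))
    (sigma : icell (leg F1 ∘ a1) (leg F2 ∘ a2)) :
  exists (N : B) (n : hom N T) (m : hom N (dg_ob d))
    (e1 : icell (dg1 d ∘ m) (a1 ∘ n)) (e2 : icell (dg2 d ∘ m) (a2 ∘ n)),
    covers W n /\ intertwines (dgL d) sigma e1 e2.
Proof.
have [N [m [n [Hn [i]]]]] := wb3 HW (leg F1 ∘ a1) (dg_in d).
have [N1 [y [e1 [Hy _]]]] :=
  lift_icell HW Hfull (ivc (iasc _ _ _) (ivc i (iasci _ _ _))) (leg_in F1).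
have [N2 [z [e2 [Hz E]]]] := intertwines_lift (dgL d) sigma e1.
exists N2, ((n ∘ y) ∘ z), ((m ∘ y) ∘ z), (iawr e1 z), e2; split=> //.
apply: covers_comp => //; apply: covers_comp => //; exact: W_covers.
Qed.

(** Since [leg F1 ∘ dg1 d] is in [W], the comparison [e1] lifts to a 2-cell [i] between the arrows
    into the apex of [d]. *)
Lemma diagram_legs_rigid (d : diagram F1 F2) (N : B) (m m' : hom N (dg_ob d))
    (e1 : icell (dg1 d ∘ m) (dg1 d ∘ m')) (e2 : icell (dg2 d ∘ m) (dg2 d ∘ m')) :
  intertwines (dgL d) (dgL d) e1 e2 ->
  exists (U : B) (y : hom U N) (i : icell (m ∘ y) (m' ∘ y)),
    covers W y /\ dg1 d ◁ i = awr e1 y /\ dg2 d ◁ i = awr e2 y.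
Proof.
move=> E.
have [U1 [y1 [i [H1 E1]]]] := lift_icell_rw HW Hfull (iawl (leg F1) e1) (dg_in d).
(* Local faithfulness of [leg F1] will cancel it, so that [i] induces [e1] itself. *)
have {}E1 : leg F1 ◁ (dg1 d ◁ i) = leg F1 ◁ awr e1 y1.
  by apply: awl_inj; rewrite -awr_awl /awl -lw_comp.
have [U2 [y2 [H2]]] := faithful_on_cover_awr3 HW (leg_in F1) E1.
rewrite awr3_lw awr3_awr => {}E1.
(* Naturality of the invertible [dgL d] carries the equality from the first leg to the second. *)
have E2 : leg F2 ◁ (dg2 d ◁ awr i y2) = leg F2 ◁ awr e2 (y1 ∘ y2).
  apply: (@icell_cancel_r _ _ _ _ _ _ (iawr (dgL d) (m ∘ (y1 ∘ y2)))).
  have := intertwines_awr (y1 ∘ y2) E; rewrite /intertwines !iawrE => ->.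
  by rewrite awr_nat E1.
have [U3 [y3 [H3]]] := faithful_on_cover_awr3 HW (leg_in F2) E2.
rewrite awr3_lw awr3_awr => {}E2.
exists U3, ((y1 ∘ y2) ∘ y3), (iawr (iawr i y2) y3); rewrite !iawrE; split.
  by do 2!apply: covers_comp => //.
by split=> //; rewrite -awr3_lw E1 awr3_awr.
Qed.

(** By rigidity the two comparisons differ by a local 2-cell from [m] to [m'], and naturality of
    [dgR d] in it transports the right-hand equation. *)
Lemma agrees_same (d : diagram F1 F2) (T N : B)
    (a1 : hom T (apex F1)) (a2 : hom T (apex F2))
    (sigma : leg F1 ∘ a1 ⇒ leg F2 ∘ a2) (theta : arr F1 ∘ a1 ⇒ arr F2 ∘ a2)
    (n : hom N T) (m m' : hom N (dg_ob d))
    (e1 : icell (dg1 d ∘ m) (a1 ∘ n)) (e2 : icell (dg2 d ∘ m) (a2 ∘ n))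
    (e1' : icell (dg1 d ∘ m') (a1 ∘ n)) (e2' : icell (dg2 d ∘ m') (a2 ∘ n)) :
  intertwines (dgL d) sigma e1 e2 ->
  intertwines (dgL d) sigma e1' e2' -> intertwines (dgR d) theta e1' e2' ->
  exists (U : B) (y : hom U N), covers W y /\
    intertwines (dgR d) theta (awr e1 y) (awr e2 y).
Proof.
move=> EL EL' ER'.
have [|U [y [i [Hy [I1 I2]]]]] := @diagram_legs_rigid d N m m'
  (ivc (iinv e1') e1) (ivc (iinv e2') e2).
  exact: intertwines_vc EL (intertwines_inv EL').
exists U, y; split=> //.
have C C1 s (a : hom T C1) (e : icell (s ∘ m) (a ∘ n)) (e' : icell (s ∘ m') (a ∘ n)) :
    awr e' y • awr (ivc (iinv e') e) y = awr e y.
  by rewrite -awr_vc /= vc_assoc icell_invr vc_id_l.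
rewrite -(C _ _ _ e1 e1') -(C _ _ _ e2 e2') -I1 -I2.
by apply: (intertwines_vc (b' := dgR d));
  [exact: intertwines_lw | exact: intertwines_awr].
Qed.

(** The restriction of a 2-cell of fractions along [sigma] is locally unique. *)
Lemma agrees_all (d : diagram F1 F2) (T N : B)
    (a1 : hom T (apex F1)) (a2 : hom T (apex F2))
    (sigma : leg F1 ∘ a1 ⇒ leg F2 ∘ a2) (theta : arr F1 ∘ a1 ⇒ arr F2 ∘ a2)
    (n : hom N T) (m : hom N (dg_ob d))
    (e1 : icell (dg1 d ∘ m) (a1 ∘ n)) (e2 : icell (dg2 d ∘ m) (a2 ∘ n)) :
  agrees d sigma theta -> intertwines (dgL d) sigma e1 e2 ->
  exists (U : B) (y : hom U N), covers W y /\
    intertwines (dgR d) theta (awr e1 y) (awr e2 y).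
Proof.
move=> [N' [n' [m' [e1' [e2' [Hn' [EL' ER']]]]]]] EL.
(* The cover that witnesses agreement is pulled back along [n], so that both comparisons live over
   [n ∘ y]. *)
have [V [y [y' [Hy [i]]]]] := covers_pull HW n Hn'.
have P (C1 C2 Q : B) (f1 : hom C1 Q) (f2 : hom C2 Q) s1 s2 (b : f1 ∘ s1 ⇒ f2 ∘ s2)
    (t1 : hom T C1) (t2 : hom T C2) (t : f1 ∘ t1 ⇒ f2 ∘ t2)
    (i1 : icell (s1 ∘ m') (t1 ∘ n')) (i2 : icell (s2 ∘ m') (t2 ∘ n')) :
    intertwines b t i1 i2 ->
    intertwines b t (ivc (ilw t1 i) (iawr i1 y')) (ivc (ilw t2 i) (iawr i2 y')).
  move=> E; apply: (intertwines_vc (b' := t)); last exact: intertwines_lw.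
  exact: intertwines_awr.
have [U [z [Hz E]]] := agrees_same (e1 := iawr e1 y) (e2 := iawr e2 y)
  (intertwines_awr y EL) (P _ _ _ _ _ _ _ _ _ _ _ _ _ EL')
  (P _ _ _ _ _ _ _ _ _ _ _ _ _ ER').
exists U, (y ∘ z); split; first exact: covers_comp.
by apply: intertwines_awr_comp; rewrite -!iawrE.
Qed.

End Agreement.

(** * Restriction of composites *)

Section Tails.
Context (B : bicategory).

Lemma intertwines_conj (C1 C2 E1 E2 D T N Y : B) (f1 : hom C1 Y) (f2 : hom C2 Y)
    (v1 : hom E1 C1) (v2 : hom E2 C2) (p1 : hom D E1) (p2 : hom D E2)
    (b : (f1 ∘ v1) ∘ p1 ⇒ (f2 ∘ v2) ∘ p2) (a1 : hom T E1) (a2 : hom T E2)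
    (t : (f1 ∘ v1) ∘ a1 ⇒ (f2 ∘ v2) ∘ a2) (m : hom N D) (n : hom N T)
    (e1 : p1 ∘ m ⇒ a1 ∘ n) (e2 : p2 ∘ m ⇒ a2 ∘ n) :
  intertwines b t e1 e2 <->
  (f2 ◁ (v2 ◁ e2)) • awr3 (asc f2 v2 p2 • b • asci f1 v1 p1) m
  = awr3 (asc f2 v2 a2 • t • asci f1 v1 a1) n • (f1 ◁ (v1 ◁ e1)).
Proof.
rewrite /intertwines !awr3_conj !lw_comp; split=> E.
  apply: (@icell_cancel_l _ _ _ _ _ _ (iasci f2 v2 (a2 ∘ n))).
  apply: (@icell_cancel_r _ _ _ _ _ _ (iasc f1 v1 (p1 ∘ m))) => /=.
  vcr; rewrite asci_asc_r asci_asc vc_id_r.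
  by move: E; vcr.
apply: (@icell_cancel_l _ _ _ _ _ _ (iasc f2 v2 (a2 ∘ n))).
apply: (@icell_cancel_r _ _ _ _ _ _ (iasci f1 v1 (p1 ∘ m))) => /=.
by vcr; rewrite asc_asci_r asc_asci vc_id_r; move: E; vcr.
Qed.

(** Diagrams of composites are restricted along [x] first; bracketing the source as [x ∘ (m ∘ y)]
    keeps [x] exposed under further restrictions. *)
Definition awr_tail (C1 D E T N U : B) (s : hom D C1) (x : hom E D) (m : hom N E)
    (a : hom T C1) (n : hom N T) (e : s ∘ (x ∘ m) ⇒ a ∘ n) (y : hom U N) :
    s ∘ (x ∘ (m ∘ y)) ⇒ a ∘ (n ∘ y) :=
  awr e y • (s ◁ asci x m y).

Definition iawr_tail (C1 D E T N U : B) (s : hom D C1) (x : hom E D)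
    (m : hom N E) (a : hom T C1) (n : hom N T) (e : icell (s ∘ (x ∘ m)) (a ∘ n))
    (y : hom U N) : icell (s ∘ (x ∘ (m ∘ y))) (a ∘ (n ∘ y)) :=
  ivc (iawr e y) (ilw s (iasci x m y)).

Lemma awr_tail_asci (C1 D E T N U : B) (s : hom D C1) (x : hom E D) (m : hom N E)
    (a : hom T C1) (n : hom N T) (e : (s ∘ x) ∘ m ⇒ a ∘ n) (y : hom U N) :
  awr_tail (e • asci s x m) y = awr e y • asci s x (m ∘ y).
Proof.
by rewrite /awr_tail awr_vc awr_asci; vcr; rewrite lw_asc_asci vc_id_r.
Qed.

Lemma awr_tail_awr (C1 D D' E T N U : B) (s : hom D C1) (x : hom E D)
    (s' : hom D' C1) (x' : hom E D') (m : hom N E)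
    (a : hom T C1) (n : hom N T) (e : s' ∘ (x' ∘ m) ⇒ a ∘ n)
    (b : s ∘ x ⇒ s' ∘ x') (y : hom U N) :
  awr_tail (e • awr b m) y = awr_tail e y • awr b (m ∘ y).
Proof.
rewrite /awr_tail awr_vc (awr_awr3 (awr b m)) awr3_awr; vcr.
by rewrite lw_asc_asci vc_id_r.
Qed.

Lemma intertwines_tail (C1 C2 D E T N U Y : B) (f1 : hom C1 Y) (f2 : hom C2 Y)
    (s1 : hom D C1) (s2 : hom D C2) (b : f1 ∘ s1 ⇒ f2 ∘ s2) (x : hom E D)
    (m : hom N E) (a1 : hom T C1) (a2 : hom T C2) (t : f1 ∘ a1 ⇒ f2 ∘ a2)
    (n : hom N T) (e1 : s1 ∘ (x ∘ m) ⇒ a1 ∘ n) (e2 : s2 ∘ (x ∘ m) ⇒ a2 ∘ n)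
    (y : hom U N) :
  intertwines b t (awr e1 y) (awr e2 y) ->
  intertwines b t (awr_tail e1 y) (awr_tail e2 y).
Proof. by apply: intertwines_vc; exact: intertwines_lw. Qed.

Section Paste.
Context (C1 C2 C3 D D' V T N Y : B).
Context (f1 : hom C1 Y) (f2 : hom C2 Y) (f3 : hom C3 Y).
Context (s1 : hom D C1) (s2 : hom D C2) (b1 : f1 ∘ s1 ⇒ f2 ∘ s2).
Context (s3 : hom D' C2) (s4 : hom D' C3) (b2 : f2 ∘ s3 ⇒ f3 ∘ s4).
Context (x1 : hom V D) (x2 : hom V D') (j : icell (s2 ∘ x1) (s3 ∘ x2)).
Context (a1 : hom T C1) (a2 : hom T C2) (a3 : hom T C3).
Context (t1 : f1 ∘ a1 ⇒ f2 ∘ a2) (t2 : f2 ∘ a2 ⇒ f3 ∘ a3).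
Context (m : hom N V) (n : hom N T).
Context (e1 : (s1 ∘ x1) ∘ m ⇒ a1 ∘ n) (e2 : s2 ∘ (x1 ∘ m) ⇒ a2 ∘ n).
Context (e3 : (s4 ∘ x2) ∘ m ⇒ a3 ∘ n).

Let paste := awr b2 x2 • (f2 ◁ j) • awr b1 x1.

Lemma intertwines_paste_iff :
  intertwines paste (t2 • t1) e1 e3 <->
  (f3 ◁ (e3 • asci s4 x2 m)) • awr b2 (x2 ∘ m) • (f2 ◁ awr j m)
    • awr b1 (x1 ∘ m) = awr t2 n • awr t1 n • (f1 ◁ (e1 • asci s1 x1 m)).
Proof.
rewrite /intertwines awr_awr3 !awr3_vc !awr3_awr awr3_lw (awr_vc t2 t1) !lw_vc.
split=> E.
  apply: (@icell_cancel_r _ _ _ _ _ _ (ilw f1 (iasc s1 x1 m))) => /=.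
  by vcr; rewrite lw_asci_asc vc_id_r; move: E; vcr.
apply: (@icell_cancel_r _ _ _ _ _ _ (ilw f1 (iasci s1 x1 m))) => /=.
by vcr; rewrite lw_asc_asci vc_id_r; move: E; vcr.
Qed.

(** The comparison [e2] of the middle legs serves both factors: as it stands for the first,
    transported across [j] for the second. *)
Lemma intertwines_paste :
  intertwines b1 t1 (e1 • asci s1 x1 m) e2 ->
  intertwines b2 t2 (e2 • awr (icell_inv j) m) (e3 • asci s4 x2 m) ->
  intertwines paste (t2 • t1) e1 e3.
Proof.
move=> E1 E2; apply/intertwines_paste_iff.
rewrite -(vc_assoc (awr t2 n)) -E1 E2 (lw_vc f2 e2); vcr.
by rewrite (vc_assoc (f2 ◁ awr (icell_inv j) m)) -lw_vc awr_invl lw_id vc_id_l.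
Qed.

(** Meant for left-hand 2-cells: they are invertible, so the first factor can be cancelled from the
    composite. *)
Lemma intertwines_unpaste : invertible b1 ->
  intertwines b1 t1 (e1 • asci s1 x1 m) e2 ->
  intertwines paste (t2 • t1) e1 e3 ->
  intertwines b2 t2 (e2 • awr (icell_inv j) m) (e3 • asci s4 x2 m).
Proof.
move=> [i Ei] E1 /intertwines_paste_iff; rewrite -(vc_assoc (awr t2 n)) -E1 => E.
have {}E : (f3 ◁ (e3 • asci s4 x2 m)) • awr b2 (x2 ∘ m) • (f2 ◁ awr j m)
    = awr t2 n • (f2 ◁ e2).
  apply: (@icell_cancel_r _ _ _ _ _ _ (iawr i (x1 ∘ m))).
  by rewrite iawrE Ei E vc_assoc.
apply: (@icell_cancel_r _ _ _ _ _ _ (ilw f2 (iawr j m))).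
have -> : icell_cell (ilw f2 (iawr j m)) = f2 ◁ awr j m by [].
rewrite E lw_vc; vcr.
by rewrite -lw_vc awr_invl lw_id vc_id_r.
Qed.

End Paste.

End Tails.

Section Operations.
Context (B : bicategory) (W : arrow_class B) (HW : WBconditions W).
Context (Hfull : forall (X Y : B) (w : hom X Y), W w -> full w).

Section Vertical.
Context (X Y : B) (F1 F2 F3 : span W X Y).

(** A comparison for the left-hand 2-cells of the composite exists and splits into comparisons for
    the two factors; local uniqueness of restrictions then yields their right-hand equations. *)
Lemma agrees_vcomp (H5 : WB5 W) (d1 : diagram F1 F2) (d2 : diagram F2 F3)
    (c : vcomp_data d1 d2) (T : B)
    (a1 : hom T (apex F1)) (a2 : hom T (apex F2)) (a3 : hom T (apex F3))
    (sigma1 : icell (leg F1 ∘ a1) (leg F2 ∘ a2))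
    (sigma2 : icell (leg F2 ∘ a2) (leg F3 ∘ a3))
    (theta1 : arr F1 ∘ a1 ⇒ arr F2 ∘ a2) (theta2 : arr F2 ∘ a2 ⇒ arr F3 ∘ a3) :
  agrees d1 sigma1 theta1 -> agrees d2 sigma2 theta2 ->
  agrees (vcomp_diagram H5 c) (sigma2 • sigma1) (theta2 • theta1).
Proof.
move=> A1 A2.
have [N [n [m [e1 [e3 [Hn EL]]]]]] :=
  agrees_exists HW Hfull (vcomp_diagram H5 c) (ivc sigma2 sigma1).
(* The comparison of the middle legs is lifted from that of the first legs. *)
have [N1 [y [e2 [Hy EL1]]]] := intertwines_lift HW Hfull (dgL d1) sigma1
  (ivc e1 (iasci (dg1 d1) (vd_x1 c) m)).
have {}EL := intertwines_awr y EL.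
set m1 : hom N1 (vd_ob c) := m ∘ y; set n1 := n ∘ y.
pose f1 : icell ((dg1 d1 ∘ vd_x1 c) ∘ m1) (a1 ∘ n1) := iawr e1 y.
pose f3 : icell ((dg2 d2 ∘ vd_x2 c) ∘ m1) (a3 ∘ n1) := iawr e3 y.
pose f2 : icell (dg2 d1 ∘ (vd_x1 c ∘ m1)) (a2 ∘ n1) :=
  ivc e2 (ilw (dg2 d1) (iasci (vd_x1 c) m y)).
have {}EL1 : intertwines (dgL d1) sigma1
    (ivc f1 (iasci (dg1 d1) (vd_x1 c) m1)) f2.
  have -> : icell_cell (ivc f1 (iasci (dg1 d1) (vd_x1 c) m1))
      = awr_tail (e1 • asci (dg1 d1) (vd_x1 c) m) y by rewrite awr_tail_asci.
  by apply: intertwines_vc; [exact: intertwines_lw | exact: EL1].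
have EL2 : intertwines (dgL d2) sigma2
    (ivc f2 (iawr (iinv (vd_delta c)) m1)) (ivc f3 (iasci (dg2 d2) (vd_x2 c) m1)).
  by apply: (intertwines_unpaste _ EL1 EL); exists (dgL d1).
(* [A1] and [A2] each speak of some comparison; [agrees_all] moves them to the present one, at the
   price of one cover each. *)
have [N2 [y1 [Hy1 ER1]]] := agrees_all HW Hfull A1 EL1.
have {}ER1 := intertwines_tail ER1; rewrite !awr_tail_asci in ER1.
have {}EL2 := intertwines_tail (intertwines_awr y1 EL2).
have [N3 [y2 [Hy2 ER2]]] := agrees_all HW Hfull A2
  (e1 := iawr_tail (ivc f2 (iawr (iinv (vd_delta c)) m1)) y1)
  (e2 := iawr_tail (ivc f3 (iasci (dg2 d2) (vd_x2 c) m1)) y1) EL2.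
have {}ER1 := intertwines_tail (intertwines_awr y2 ER1).
have {}ER2 := intertwines_tail ER2.
exists N3, ((n1 ∘ y1) ∘ y2), ((m1 ∘ y1) ∘ y2).
exists (iawr (iawr f1 y1) y2), (iawr (iawr f3 y1) y2).
split; first by do 3!apply: covers_comp => //.
rewrite !iawrE; split; first by do 2!apply: intertwines_awr; exact: EL.
apply: intertwines_paste.
  by rewrite -awr_tail_asci; exact: ER1.
rewrite -awr_tail_asci -awr_tail_awr.
have -> : awr_tail f2 y1 • awr (icell_inv (vd_delta c)) (m1 ∘ y1)
    = awr_tail (ivc f2 (iawr (iinv (vd_delta c)) m1)) y1 by rewrite -awr_tail_awr.
by rewrite -awr_tail_asci; exact: ER2.
Qed.

End Vertical.
(** [agrees_all] in the bracketing that the legs of composite spans produce. *)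
Lemma agrees_all_comp (X Y : B) (F1 F2 : span W X Y) (d : diagram F1 F2) (T N E V1 V2 : B)
    (v1 : hom V1 (apex F1)) (v2 : hom V2 (apex F2))
    (a1 : hom T V1) (a2 : hom T V2)
    (sigma : leg F1 ∘ (v1 ∘ a1) ⇒ leg F2 ∘ (v2 ∘ a2))
    (theta : arr F1 ∘ (v1 ∘ a1) ⇒ arr F2 ∘ (v2 ∘ a2))
    (n : hom N T) (k : hom E (dg_ob d)) (m : hom N E)
    (e1 : icell (dg1 d ∘ (k ∘ m)) (v1 ∘ (a1 ∘ n)))
    (e2 : icell (dg2 d ∘ (k ∘ m)) (v2 ∘ (a2 ∘ n))) :
  agrees d sigma theta ->
  (leg F2 ◁ e2) • awr (dgL d) (k ∘ m) = awr3 sigma n • (leg F1 ◁ e1) ->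
  exists (U : B) (y : hom U N), covers W y /\
    (arr F2 ◁ awr3 e2 y) • awr (dgR d) (k ∘ (m ∘ y))
    = awr3 theta (n ∘ y) • (arr F1 ◁ awr3 e1 y).
Proof.
move=> A EL.
have [|U [y [Hy ER]]] := agrees_all HW Hfull (n := n)
  (e1 := ivc (iasci v1 a1 n) e1) (e2 := ivc (iasci v2 a2 n) e2) A.
  rewrite /intertwines awr_awr3 /= !lw_vc; vcr.
  by rewrite EL; vcr; rewrite lw_asc_asci_r.
exists U, y; split=> //.
have P C1 V (s : hom (dg_ob d) C1) (v : hom V C1) (a : hom T V)
    (e : s ∘ (k ∘ m) ⇒ v ∘ (a ∘ n)) :
    awr3 e y = asc v a (n ∘ y) • awr_tail (asci v a n • e) y.
  rewrite /awr_tail awr3E awr_vc awr_asci; vcr.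
  by rewrite asc_asci_r.
rewrite !P (lw_vc _ (asc v1 _ _)) (lw_vc _ (asc v2 _ _)); vcr.
have := intertwines_tail ER; rewrite /intertwines /= => ->.
rewrite (awr_awr3 theta (n ∘ y)); vcr.
by rewrite lw_asc_asci_r.
Qed.

Section Whiskerings.
Context (sq : square_choice W) (X Y Z : B).

(** [ld_btilde c] and [theta] lift conjugates of [dgR d] and [phi] through [leg G]. Agreement of [d]
    with [phi] compares these conjugates, and local faithfulness removes [leg G]. *)
Lemma agrees_lwhisk (F1 F2 : span W X Y) (d : diagram F1 F2) (G : span W Y Z)
    (c : lwhisk_data sq d G) (T : B)
    (a1 : hom T (sq_ob (sq F1 G))) (a2 : hom T (sq_ob (sq F2 G)))
    (sigma : icell ((leg F1 ∘ vbar (sq F1 G)) ∘ a1) ((leg F2 ∘ vbar (sq F2 G)) ∘ a2))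
    (phi : arr F1 ∘ (vbar (sq F1 G) ∘ a1) ⇒ arr F2 ∘ (vbar (sq F2 G) ∘ a2))
    (theta : fbar (sq F1 G) ∘ a1 ⇒ fbar (sq F2 G) ∘ a2) :
  agrees d (asc (leg F2) (vbar (sq F2 G)) a2 • sigma
            • asci (leg F1) (vbar (sq F1 G)) a1) phi ->
  leg G ◁ theta = awr (icell_inv (sq_cell (sq F2 G))) a2 • phi
    • awr (sq_cell (sq F1 G)) a1 ->
  agrees (lwhisk_diagram c) sigma (awl (arr G) theta).
Proof.
move=> A Etheta.
have [N [n [m [e1 [e2 [Hn EL]]]]]] :=
  agrees_exists HW Hfull (lwhisk_diagram c) sigma.
(* Composing with [ld_mu2 c] and the inverse of [ld_mu1 c] turns the comparison for the whiskered
   diagram into one for [d]. *)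
have {}EL1 : (leg F2 ◁ ((vbar (sq F2 G) ◁ e2) • awr (ld_mu2 c) m))
      • awr (dgL d) (ld_k c ∘ m)
    = awr3 (asc (leg F2) (vbar (sq F2 G)) a2 • sigma
            • asci (leg F1) (vbar (sq F1 G)) a1) n
      • (leg F1 ◁ ((vbar (sq F1 G) ◁ e1) • awr (icell_inv (ld_mu1 c)) m)).
  apply: (@icell_cancel_r _ _ _ _ _ _ (ilw (leg F1) (iawr (ld_mu1 c) m))).
  have -> : icell_cell (ilw (leg F1) (iawr (ld_mu1 c) m)) = leg F1 ◁ awr (ld_mu1 c) m.
    by [].
  move/intertwines_conj: EL.
  have -> : asc (leg F2) (vbar (sq F2 G)) (ld_p2 c) • dgL (lwhisk_diagram c)
      • asci (leg F1) (vbar (sq F1 G)) (ld_p1 c)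
    = (leg F2 ◁ ld_mu2 c) • awr (dgL d) (ld_k c) • (leg F1 ◁ ld_mu1 c).
    have -> : icell_cell (dgL (lwhisk_diagram c))
      = asci (leg F2) (vbar (sq F2 G)) (ld_p2 c) • (leg F2 ◁ ld_mu2 c)
        • iawr (dgL d) (ld_k c) • (leg F1 ◁ ld_mu1 c)
        • asc (leg F1) (vbar (sq F1 G)) (ld_p1 c) by [].
    by rewrite iawrE; vcr; rewrite asc_asci_r asc_asci vc_id_r.
  rwall awr3_vc; rewrite !awr3_lw awr3_awr; rwall lw_vc; vcr => ->.
  by rewrite -(lw_vc (leg F1) (awr _ m)) awr_invl lw_id vc_id_r.
have [N1 [y [Hy ER]]] := agrees_all_comp
  (e1 := ivc (ilw (vbar (sq F1 G)) e1) (iawr (iinv (ld_mu1 c)) m))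
  (e2 := ivc (ilw (vbar (sq F2 G)) e2) (iawr (ld_mu2 c) m)) A EL1.
have E1 : awr3 (ivc (ilw (vbar (sq F1 G)) e1) (iawr (iinv (ld_mu1 c)) m)) y
    = (vbar (sq F1 G) ◁ awr e1 y) • awr (icell_inv (ld_mu1 c)) (m ∘ y).
  by rewrite [LHS]awr3_vc awr3_lw awr3_awr.
have E2 : awr3 (ivc (ilw (vbar (sq F2 G)) e2) (iawr (ld_mu2 c) m)) y
    = (vbar (sq F2 G) ◁ awr e2 y) • awr (ld_mu2 c) (m ∘ y).
  by rewrite [LHS]awr3_vc awr3_lw awr3_awr.
move: ER; rewrite {}E1 {}E2 => ER.
(* After [ld_eq c] and [Etheta] are substituted, naturality of the two squares moves [e1] and [e2]
   across them. *)
have {}ER : leg G ◁ ((fbar (sq F2 G) ◁ awr e2 y) • awr (ld_btilde c) (m ∘ y))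
    = leg G ◁ (awr theta (n ∘ y) • (fbar (sq F1 G) ◁ awr e1 y)).
  rewrite (lw_vc _ (fbar (sq F2 G) ◁ _)) (lw_vc _ (awr theta _)).
  rewrite -(awr3_lw _ (ld_btilde c)) -(awr3_lw _ theta) (ld_eq c) Etheta.
  rwall awr3_vc; rewrite !awr3_lw !awr3_awr; vcr.
  rewrite -awr_nat (vc_eq_r (awr_nat (icell_inv _) (awr e2 y))).
  have {}ER : (arr F2 ◁ (vbar (sq F2 G) ◁ awr e2 y))
        • ((arr F2 ◁ awr (ld_mu2 c) (m ∘ y))
        • (awr (dgR d) (ld_k c ∘ (m ∘ y)) • (arr F1 ◁ awr (ld_mu1 c) (m ∘ y))))
      = awr3 phi (n ∘ y) • (arr F1 ◁ (vbar (sq F1 G) ◁ awr e1 y)).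
    have := vc_eq_r ER (arr F1 ◁ awr (ld_mu1 c) (m ∘ y)).
    rwall lw_vc; vcr => ->.
    by rewrite -(lw_vc _ (awr _ _)) awr_invl lw_id vc_id_r.
  have := vc_eq_r ER (awr (sq_cell (sq F1 G)) (ld_p1 c ∘ (m ∘ y))); vcr => ->.
  by [].
have [N2 [z [Hz]]] := faithful_on_cover_awr3 HW (leg_in G) ER.
rwall awr3_vc; rewrite !awr3_lw !awr3_awr => {}ER.
exists N2, ((n ∘ y) ∘ z), ((m ∘ y) ∘ z), (iawr (iawr e1 y) z), (iawr (iawr e2 y) z).
split; first by do 2!apply: covers_comp => //.
rewrite !iawrE; split; first by do 2!apply: intertwines_awr.
apply/intertwines_conj.
have -> : dgR (lwhisk_diagram c) = awl (arr G) (ld_btilde c) by [].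
rewrite !asc_awl_asci !awr3_lw -!(lw_vc (arr G)).
have -> : (fbar (sq F2 G) ◁ awr (awr e2 y) z)
    • awr (ld_btilde c) ((m ∘ y) ∘ z)
  = awr theta ((n ∘ y) ∘ z) • (fbar (sq F1 G) ◁ awr (awr e1 y) z) by [].
by [].
Qed.

(** The comparison of [rd_lambda c] with [sigma] is carried by the squares to one of [dgL d] with
    [psi], where the agreement of [d] applies. *)
Lemma agrees_rwhisk (F : span W X Y) (G1 G2 : span W Y Z) (d : diagram G1 G2)
    (c : rwhisk_data sq F d) (T : B)
    (a1 : hom T (sq_ob (sq F G1))) (a2 : hom T (sq_ob (sq F G2)))
    (sigma : icell (vbar (sq F G1) ∘ a1) (vbar (sq F G2) ∘ a2))
    (psi : leg G1 ∘ (fbar (sq F G1) ∘ a1) ⇒ leg G2 ∘ (fbar (sq F G2) ∘ a2))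
    (theta : arr G1 ∘ (fbar (sq F G1) ∘ a1) ⇒ arr G2 ∘ (fbar (sq F G2) ∘ a2)) :
  agrees d psi theta ->
  awr (sq_cell (sq F G2)) a2 • psi = (arr F ◁ sigma) • awr (sq_cell (sq F G1)) a1 ->
  agrees (rwhisk_diagram c) (awl (leg F) sigma)
    (asci (arr G2) (fbar (sq F G2)) a2 • theta • asc (arr G1) (fbar (sq F G1)) a1).
Proof.
move=> A Epsi.
have [N [n [m [e1 [e2 [Hn EL]]]]]] :=
  agrees_exists HW Hfull (rwhisk_diagram c) (iawl (leg F) sigma).
(* Both left-hand 2-cells are whiskerings by [leg F], which local faithfulness then removes. *)
have E : leg F ◁ ((vbar (sq F G2) ◁ e2) • awr (rd_lambda c) m)
    = leg F ◁ (awr sigma n • (vbar (sq F G1) ◁ e1)).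
  move/intertwines_conj: EL.
  have -> : icell_cell (dgL (rwhisk_diagram c)) = awl (leg F) (rd_lambda c) by [].
  have -> : icell_cell (iawl (leg F) sigma) = awl (leg F) sigma by [].
  by rewrite !asc_awl_asci !awr3_lw -!(lw_vc (leg F)).
have [N1 [y [Hy]]] := faithful_on_cover_awr3 HW (leg_in F) E.
rwall awr3_vc; rewrite !awr3_lw !awr3_awr => {}E.
(* The square for [F] and [G2] is invertible, so [Epsi] can be solved for [psi]. *)
have E1 : awr3 psi (n ∘ y)
    = awr (icell_inv (sq_cell (sq F G2))) (a2 ∘ (n ∘ y)) •
     ((arr F ◁ awr sigma (n ∘ y)) • awr (sq_cell (sq F G1)) (a1 ∘ (n ∘ y))).
  rewrite -awr3_lw -[X in _ • (_ • X)]awr3_awr -awr3_vc -Epsi awr3_vc awr3_awr.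
  by rewrite vc_assoc awr_invl vc_id_l.
have {}E : (leg G2 ◁ ((fbar (sq F G2) ◁ awr e2 y) • awr (rd_kappa2 c) (m ∘ y)))
      • awr (dgL d) (rd_h c ∘ (m ∘ y))
    = awr3 psi (n ∘ y)
      • (leg G1 ◁ ((fbar (sq F G1) ◁ awr e1 y) • awr (icell_inv (rd_kappa1 c)) (m ∘ y))).
  have R : awr3 (awr (sq_cell (sq F G2)) (rd_p2 c) • (leg G2 ◁ rd_kappa2 c)
      • awr (dgL d) (rd_h c) • (leg G1 ◁ rd_kappa1 c)) (m ∘ y) = awr3
    ((arr F ◁ rd_lambda c) • awr (sq_cell (sq F G1)) (rd_p1 c)) (m ∘ y) by rewrite rd_eq.
  move: R; rwall awr3_vc; rewrite !awr3_lw !awr3_awr; vcr => R.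
  rewrite {}E1.
  apply: (@icell_cancel_l _ _ _ _ _ _ (iawr (sq_cell (sq F G2)) (a2 ∘ (n ∘ y)))).
  apply: (@icell_cancel_r _ _ _ _ _ _ (ilw (leg G1) (iawr (rd_kappa1 c) (m ∘ y)))).
  have -> : icell_cell (ilw (leg G1) (iawr (rd_kappa1 c) (m ∘ y)))
    = leg G1 ◁ awr (rd_kappa1 c) (m ∘ y) by [].
  rewrite iawrE; rwall lw_vc; vcr.
  rewrite (vc_eq_r (awr_invr _ _)) vc_id_l -(lw_vc _ (awr _ _)) awr_invl lw_id vc_id_r.
  rewrite -(awr_nat (sq_cell (sq F G1)) (awr e1 y)).
  rewrite (vc_eq_r (eq_sym (awr_nat (sq_cell (sq F G2)) (awr e2 y)))); vcr.
  cbn [dg1 dg2 rwhisk_diagram]; rewrite R.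
  by rewrite vc_assoc -lw_vc E (lw_vc _ (awr _ _)); vcr.
have [N2 [z [Hz]]] := agrees_all_comp
  (e1 := ivc (ilw (fbar (sq F G1)) (iawr e1 y)) (iawr (iinv (rd_kappa1 c)) (m ∘ y)))
  (e2 := ivc (ilw (fbar (sq F G2)) (iawr e2 y)) (iawr (rd_kappa2 c) (m ∘ y))) A E.
have E3 : awr3 (ivc (ilw (fbar (sq F G1)) (iawr e1 y))
      (iawr (iinv (rd_kappa1 c)) (m ∘ y))) z
    = (fbar (sq F G1) ◁ awr (awr e1 y) z) • awr (icell_inv (rd_kappa1 c)) ((m ∘ y) ∘ z).
  by rewrite [LHS]awr3_vc awr3_lw awr3_awr.
have E4 : awr3 (ivc (ilw (fbar (sq F G2)) (iawr e2 y)) (iawr (rd_kappa2 c) (m ∘ y))) z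
    = (fbar (sq F G2) ◁ awr (awr e2 y) z) • awr (rd_kappa2 c) ((m ∘ y) ∘ z).
  by rewrite [LHS]awr3_vc awr3_lw awr3_awr.
rewrite {}E3 {}E4 => ER.
exists N2, ((n ∘ y) ∘ z), ((m ∘ y) ∘ z), (iawr (iawr e1 y) z), (iawr (iawr e2 y) z).
split; first by do 2!apply: covers_comp => //.
rewrite !iawrE; split; first by do 2!apply: intertwines_awr.
apply/intertwines_conj.
have -> : dgR (rwhisk_diagram c)
  = asci (arr G2) (fbar (sq F G2)) (rd_p2 c)
       • (arr G2 ◁ rd_kappa2 c) • awr (dgR d) (rd_h c)
       • (arr G1 ◁ rd_kappa1 c)
       • asc (arr G1) (fbar (sq F G1)) (rd_p1 c) by [].
vcr; rewrite !asc_asci_r !asc_asci !vc_id_r.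
rwall awr3_vc; rewrite !awr3_lw !awr3_awr.
move: ER; rwall lw_vc; vcr => ER.
have := vc_eq_r ER (arr G1 ◁ awr (rd_kappa1 c) ((m ∘ y) ∘ z)); vcr => E4.
rewrite {}E4 -(lw_vc (arr G1) (awr _ _)) awr_invl lw_id vc_id_r.
by [].
Qed.

End Whiskerings.
End Operations.

(** * Existence of the auxiliary data in the three operations *)

Section Choices.
Context (B : bicategory) (W : arrow_class B) (HW : WBconditions W).
Context (Hfull : forall (X Y : B) (w : hom X Y), W w -> full w).

(** [WB3] factors [w ∘ b] through [w ∘ v] over an arrow of [W], up to an invertible 2-cell; lifting
    that 2-cell removes [w]. *)
Lemma factor_on_cover (X Y Z T : B) (w : hom Y Z) (v : hom X Y) (b : hom T Y) :
  W w -> W (w ∘ v) ->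
  exists (N : B) (n : hom N T) (p : hom N X),
    covers W n /\ inhabited (icell (v ∘ p) (b ∘ n)).
Proof.
move=> Hw Hwv; have [N [p [n [Hn [i]]]]] := wb3 HW (w ∘ b) Hwv.
have [U [y [j [Hy _]]]] :=
  lift_icell HW Hfull (ivc (iasc w b n) (ivc i (iasci w v p))) Hw.
exists U, (n ∘ y), (p ∘ y); split; last by constructor.
by apply: covers_comp => //; exact: W_covers.
Qed.

Lemma vcomp_data_exists (X Y : B) (F1 F2 F3 : span W X Y)
    (d1 : diagram F1 F2) (d2 : diagram F2 F3) : inhabited (vcomp_data d1 d2).
Proof.
have [N [n [p [Hn [i]]]]] := factor_on_cover (dg2 d1) (leg_in F2) (dg_in d2).
have Hd : W (leg F2 ∘ dg2 d1) by apply: W_iso HW _ _ _ _ (iinv (dgL d1)) (dg_in d1).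
have [U [y Hy]] := W_comp_covers HW Hd Hn.
constructor; apply: (@VcompData _ _ _ _ _ _ _ _ _ U (n ∘ y) (p ∘ y)).
  exact: iinv (iawr i y).
apply: W_iso HW _ _ _ _ _ Hy.
exact: ivc (iasci _ _ _) (iasci _ _ _).
Qed.

Context (sq : square_choice W).

(** [dg1 d] is factored through the first square and then, over the same domain, [dg2 d] through the
    second; fullness of [leg G] supplies [ld_btilde]. *)
Lemma lwhisk_data_exists (X Y Z : B) (F1 F2 : span W X Y) (d : diagram F1 F2)
    (G : span W Y Z) : inhabited (lwhisk_data sq d G).
Proof.
have [N1 [n1 [p1 [H1 [i1]]]]] :=
  factor_on_cover (dg1 d) (leg_in F1) (sq_in (sq F1 G)).
have [N2 [n2 [p2 [H2 [i2]]]]] :=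
  factor_on_cover (dg2 d ∘ n1) (leg_in F2) (sq_in (sq F2 G)).
have [U [y Hy]] := W_comp_covers HW (dg_in d) (covers_comp HW H1 H2).
pose mu1 := iawr (iawr i1 n2) y.
pose mu2 := iawr (iinv (ivc (iasc _ _ _) i2)) y.
have [t Et] := Hfull (leg_in G) (awr (icell_inv (sq_cell (sq F2 G))) (p2 ∘ y)
  • (arr F2 ◁ mu2) • awr (dgR d) ((n1 ∘ n2) ∘ y) • (arr F1 ◁ mu1)
  • awr (sq_cell (sq F1 G)) ((p1 ∘ n2) ∘ y)).
constructor; apply: (LwhiskData Et).
apply: W_iso HW _ _ _ _ _ Hy.
refine (ivc (iasci _ _ _) (ivc (iasci _ _ _) (ivc (ilw _ mu1) (iasc _ _ _)))).
Qed.

Lemma rwhisk_data_exists (X Y Z : B) (F : span W X Y) (G1 G2 : span W Y Z)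
    (d : diagram G1 G2) : inhabited (rwhisk_data sq F d).
Proof.
have [N1 [n1 [p [H1 [i]]]]] :=
  factor_on_cover (vbar (sq F G1)) (leg_in F) (sq_in (sq F G2)).
have [N2 [n2 [h [H2 [j]]]]] :=
  factor_on_cover (fbar (sq F G1) ∘ n1) (leg_in G1) (dg_in d).
pose lambda := iinv (iawr i n2).
pose kappa := iinv (ivc (iasc _ _ _) j).
(* The equation [rd_eq] solved for its term in [rd_kappa2]; the solution is invertible and so has an
   invertible lift. *)
pose phi := ivc (ivc (ivc (ivc (iawr (iinv (sq_cell (sq F G2))) (p ∘ n2))
  (ilw (arr F) lambda)) (iawr (sq_cell (sq F G1)) (n1 ∘ n2)))
  (ilw (leg G1) (iinv kappa))) (iawr (iinv (dgL d)) h).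
have [N3 [z [t [Hz Et]]]] := lift_icell HW Hfull phi (leg_in G2).
have [U [y Hy]] := W_comp_covers HW (sq_in (sq F G1))
  (covers_comp HW (covers_comp HW H1 H2) Hz).
constructor; apply: (@RwhiskData _ _ _ _ _ _ _ _ _ _ U (((n1 ∘ n2) ∘ z) ∘ y)
  (((p ∘ n2) ∘ z) ∘ y) ((h ∘ z) ∘ y) (iawr (iawr lambda z) y)
  (iawr (iawr kappa z) y) (iawr t y)).
  by apply: W_iso HW _ _ _ _ _ Hy; exact: iasci.
have Ephi : icell_cell phi = awr (icell_inv (sq_cell (sq F G2))) (p ∘ n2)
    • (arr F ◁ lambda) • awr (sq_cell (sq F G1)) (n1 ∘ n2)
    • (leg G1 ◁ icell_inv kappa) • awr (icell_inv (dgL d)) h by [].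
rewrite iawrE -awr3_lw Et Ephi !iawrE.
rwall awr3_vc; rewrite !awr3_lw !awr3_awr; vcr.
rewrite (vc_eq_r (awr_invr _ _)) vc_id_l (vc_eq_r (awr_invl _ _)) vc_id_l.
by rewrite -(lw_vc _ (awr _ _)) -(awr_vc (awr _ _)) awr_invl awr_id2 lw_id vc_id_r.
Qed.
End Choices.

(** * The horizontal composite *)

Section Along.
Context (B : bicategory).

Lemma eqc_symK (X Y : B) (f g : hom X Y) (e : f = g) :
  eqc (eq_sym e) • eqc e = id2 f.
Proof. by case: g / e => /=; rewrite vc_id_l. Qed.

Lemma eqcK (X Y : B) (f g : hom X Y) (e : f = g) :
  eqc e • eqc (eq_sym e) = id2 g.
Proof. by case: g / e => /=; rewrite vc_id_l. Qed.

Definition ieqc (X Y : B) (f g : hom X Y) (e : f = g) : icell f g :=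
  ICell (eqc_symK e) (eqcK e).

Context (X Y Y' Z T U V : B) (f : hom Y Z) (u : hom X Y) (g : hom Y' Z).
Context (v : hom X Y') (b : f ∘ u ⇒ g ∘ v) (s : hom T X).

(** The equalities of arrows become invertible 2-cells, which can then serve as comparisons of
    legs. *)
Lemma awr3_awr3_along (D D' : B) (k : hom D Y) (a : hom T D) (k' : hom D' Y')
    (a' : hom T D') (e : u ∘ s = k ∘ a) (e' : v ∘ s = k' ∘ a')
    (m : hom U T) (y : hom V U) :
  awr3 (awr3 (awr_along b e e') m) y
  = (g ◁ awr (awr (ieqc e') m) y) • awr b ((s ∘ m) ∘ y)
    • (f ◁ icell_inv (iawr (iawr (ieqc e) m) y)).
Proof.
by rewrite iawr_invE iawr_invE /awr_along; rwall awr3_vc; rewrite !awr3_lw !awr3_awr.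
Qed.

End Along.

Lemma agrees_equiv (B : bicategory) (W : arrow_class B) (HW : WBconditions W)
    (Hfull : forall (X Y : B) (w : hom X Y), W X Y w -> full w)
    (X Y : B) (F1 F2 : span W X Y) (d d' : diagram F1 F2) (T : B)
    (a1 : hom T (apex F1)) (a2 : hom T (apex F2))
    (sigma : leg F1 ∘ a1 ⇒ leg F2 ∘ a2) (theta : arr F1 ∘ a1 ⇒ arr F2 ∘ a2) :
  diagram_equiv d d' -> agrees d sigma theta -> agrees d' sigma theta.
Proof.
move=> E; apply: (agrees_trans HW).
by apply/(diagram_equiv_agrees HW Hfull)/(diagram_equiv_sym HW).
Qed.

Section Main.
Context (B : bicategory) (W : arrow_class B) (HW : WBconditions W).
Context (Hpc : pullback_closed W).
Context (Hfull : forall (X Y : B) (w : hom X Y), W w -> full w).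
Context (pp : pullback_choice W) (sq : square_choice W) (X Y Z : B).
Context (F1 F2 : span W X Y) (G1 G2 : span W Y Z).
Context (beta : arr F1 ∘ pp_pi1 (leg_pullback pp F1 F2)
            ⇒ arr F2 ∘ pp_pi2 (leg_pullback pp F1 F2)).
Context (gamma : arr G1 ∘ pp_pi1 (leg_pullback pp G1 G2)
             ⇒ arr G2 ∘ pp_pi2 (leg_pullback pp G1 G2)).
Let H5 := wb5 HW.
Let S1 := sq F1 G1.
Let S2 := sq F2 G2.
Let S := sq F2 G1.
Let Pu := leg_pullback pp F1 F2.
Let Pv := leg_pullback pp G1 G2.
Let P := leg_pullback pp (span_comp sq F1 G1) (span_comp sq F2 G2).
Context (wu : hom (pp_ob P) (pp_ob Pu)).
Context (eu1 : pp_pi1 Pu ∘ wu = vbar S1 ∘ pp_pi1 P).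
Context (eu2 : pp_pi2 Pu ∘ wu = vbar S2 ∘ pp_pi2 P).
Context (Hwu : awr_along (pp_rho Pu) eu1 eu2
           = asc (leg F2) (vbar S2) (pp_pi2 P) • pp_rho P
             • asci (leg F1) (vbar S1) (pp_pi1 P)).
Context (Hbeta : invertible beta).
Context (wv : hom (pp_ob P) (pp_ob Pv)).
Context (ev1 : pp_pi1 Pv ∘ wv = fbar S1 ∘ pp_pi1 P).
Context (ev2 : pp_pi2 Pv ∘ wv = fbar S2 ∘ pp_pi2 P).
Context (Hwv : awr_along (pp_rho Pv) ev1 ev2
           = awr (icell_inv (sq_cell S2)) (pp_pi2 P)
             • awr_along beta eu1 eu2
             • awr (sq_cell S1) (pp_pi1 P)).

Let target := asci (arr G2) (fbar S2) (pp_pi2 P)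
  • awr_along gamma ev1 ev2 • asc (arr G1) (fbar S1) (pp_pi1 P).

(** Representatives and auxiliary choices are arbitrary, so that both inclusions between the classes
    follow. *)
Lemma hcomp_diagram_equiv (d1 : diagram F1 F2) (c1 : lwhisk_data sq d1 G1)
    (d1' : diagram (span_comp sq F1 G1) (span_comp sq F2 G1))
    (d2 : diagram G1 G2) (c2 : rwhisk_data sq F2 d2)
    (d2' : diagram (span_comp sq F2 G1) (span_comp sq F2 G2))
    (c : vcomp_data d1' d2') :
  diagram_equiv (pullback_diagram pp H5 Hpc beta) d1 ->
  diagram_equiv (lwhisk_diagram c1) d1' ->
  diagram_equiv (pullback_diagram pp H5 Hpc gamma) d2 ->
  diagram_equiv (rwhisk_diagram c2) d2' ->
  diagram_equiv (vcomp_diagram H5 c)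
    (pullback_diagram pp H5 Hpc (F1 := span_comp sq F1 G1)
       (F2 := span_comp sq F2 G2) target).
Proof.
move=> Q1 Q1' Q2 Q2'; apply/(diagram_equiv_agrees HW Hfull).
(* [m2] maps a cover of [P] to the apex of the middle span, given by the square for [F2] and
   [G1]. *)
have [M [m [m2 [Hm [i]]]]] :=
  factor_on_cover HW Hfull (vbar S2 ∘ pp_pi2 P) (leg_in F2) (sq_in S).
pose omega0 := ivc (iasc (vbar S2) (pp_pi2 P) m) i.
(* Invertibility of [beta] enters here: it makes [phi] and then [chi] invertible, so that the lift
   [t] has an inverse. *)
have [phi Ephi] : exists phi : icell (arr F1 ∘ (vbar S1 ∘ (pp_pi1 P ∘ m)))
    (arr F2 ∘ (vbar S2 ∘ (pp_pi2 P ∘ m))),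
    icell_cell phi = awr3 (awr_along beta eu1 eu2) m.
  case: Hbeta => bi <-.
  by have [phi Ephi] := awr3_icell (ivc (ivc (ilw _ (ieqc eu2)) (iawr bi wu))
    (ilw _ (iinv (ieqc eu1)))) m; exists phi.
pose chi := ivc (ivc (iawr (iinv (sq_cell S)) m2)
  (ivc (ilw (arr F2) (iinv omega0)) phi)) (iawr (sq_cell S1) (pp_pi1 P ∘ m)).
have [N [y [t [Hy Et]]]] := lift_icell HW Hfull chi (leg_in G1).
set a1 := (pp_pi1 P ∘ m) ∘ y; set a2 := m2 ∘ y; set a3 := (pp_pi2 P ∘ m) ∘ y.
pose omega : icell (vbar S ∘ a2) (vbar S2 ∘ a3) := iawr omega0 y.
pose beta3 := awr3 (awr3 (awr_along beta eu1 eu2) m) y.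
have Eomega : icell_inv omega = awr (icell_inv omega0) y.
  by apply: (@icell_cancel_l _ _ _ _ _ _ omega); rewrite icell_invr iawrE awr_invr.
have {}Et : leg G1 ◁ t = awr (icell_inv (sq_cell S)) a2
    • ((arr F2 ◁ icell_inv omega) • beta3) • awr (sq_cell S1) a1.
  rewrite Et.
  have -> : icell_cell chi = awr (icell_inv (sq_cell S)) m2
    • ((arr F2 ◁ icell_inv omega0) • phi) • iawr (sq_cell S1) (pp_pi1 P ∘ m) by [].
  by rewrite iawrE Ephi; rwall awr3_vc; rewrite awr3_lw !awr3_awr Eomega.
(* [sigma1] is defined so that its composite with [sigma2] is the restriction of [pp_rho P]. *)
pose sigma2 := iawl (leg F2) omega.
pose sigma1 := ivc (iinv sigma2) (iawr (iawr (pp_rho P) m) y).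
pose ru := iawr (iawr (ieqc eu1) m) y; pose ru' := iawr (iawr (ieqc eu2) m) y.
pose rv := iawr (iawr (ieqc ev1) m) y; pose rv' := iawr (iawr (ieqc ev2) m) y.
have E2 C (f : hom _ C) : f ◁ ivc (iinv omega) ru'
    = (f ◁ icell_inv omega) • (f ◁ awr (awr (ieqc eu2) m) y).
  by rewrite -lw_vc -!iawrE.
(* [wu], restricted to the cover, is the comparison arrow; the first legs match by [ru], the second
   by [ru'] followed by the inverse of [omega]. *)
have A1 : agrees d1' sigma1 (awl (arr G1) t).
  apply: (agrees_equiv HW Hfull Q1').
  apply: (agrees_lwhisk HW Hfull c1 (phi := (arr F2 ◁ icell_inv omega) • beta3)) => //.
  apply: (agrees_equiv HW Hfull Q1).
  apply: (@agrees_restrict _ _ HW _ _ _ _ (pullback_diagram pp H5 Hpc beta) _ _ _ _ _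
    ((wu ∘ m) ∘ y) ru (ivc (iinv omega) ru')).
    have E1 : icell_cell sigma1 = (asci (leg F2) (vbar S) a2
      • ((leg F2 ◁ icell_inv omega) • asc (leg F2) (vbar S2) a3))
      • iawr (iawr (pp_rho P) m) y by [].
    rewrite {}E1 !iawrE; vcr; rewrite asc_asci_r.
    have := awr3_awr3_along (pp_rho Pu) eu1 eu2 m y.
    rewrite Hwu !awr3_conj; vcr => E.
    have := vc_eq_r E (leg F1 ◁ ru); vcr => ->.
    by rewrite (lw_inv _ (icell_invl ru)) vc_id_r E2; vcr.
  rewrite /beta3 awr3_awr3_along; vcr.
  by rewrite (lw_inv _ (icell_invl ru)) vc_id_r E2; vcr.
pose psi := awr (icell_inv (sq_cell S2)) a3 • (arr F2 ◁ omega) • awr (sq_cell S) a2.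
(* The inverse of [t] appears because the first legs are compared by [rv] followed by [t]. *)
pose theta2 := (arr G2 ◁ rv') • awr gamma ((wv ∘ m) ∘ y) • (arr G1 ◁ icell_inv (ivc t rv)).
have A2 : agrees d2' sigma2
    (asci (arr G2) (fbar S2) a3 • theta2 • asc (arr G1) (fbar S) a2).
  apply: (agrees_equiv HW Hfull Q2').
  apply: (agrees_rwhisk HW Hfull c2 (psi := psi)); last first.
    by rewrite /psi; vcr; rewrite (vc_eq_r (awr_invr _ _)) vc_id_l.
  apply: (agrees_equiv HW Hfull Q2).
  apply: (@agrees_restrict _ _ HW _ _ _ _ (pullback_diagram pp H5 Hpc gamma) _ _ _ _ _
    ((wv ∘ m) ∘ y) (ivc t rv) rv').
    have E1 : leg G1 ◁ ivc t rv = (leg G1 ◁ t) • (leg G1 ◁ rv) by rewrite -lw_vc.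
    rewrite {}E1 Et /psi; vcr; rewrite (vc_eq_r (awr_invr _ _)) vc_id_l.
    have := awr3_awr3_along (pp_rho Pv) ev1 ev2 m y.
    rewrite Hwv; rwall awr3_vc; rewrite !awr3_awr; vcr => E.
    rewrite (vc_eq_r (lw_inv _ (icell_invr omega))) vc_id_l.
    have := vc_eq_r E (leg G1 ◁ rv); vcr => ->.
    by rewrite (lw_inv _ (icell_invl rv)) vc_id_r -!iawrE.
  rewrite /theta2; vcr.
  by rewrite (lw_inv _ (icell_invl (ivc t rv))) vc_id_r.
have A := agrees_vcomp HW Hfull H5 c A1 A2.
(* Agreement over [P] is checked on the cover [M] and then on [N]. *)
apply: (agrees_local HW Hm); apply: (agrees_local HW Hy).
have EL : sigma2 • sigma1 = awr (awr (pp_rho P) m) y.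
  by rewrite -!iawrE; exact: icell_inv_r.
(* [arr G1 ◁ t] cancels against its inverse inside [theta2]. *)
have ER : (asci (arr G2) (fbar S2) a3 • theta2 • asc (arr G1) (fbar S) a2)
    • awl (arr G1) t = awr (awr target m) y.
  apply: (@icell_cancel_l _ _ _ _ _ _ (iasc (arr G2) (fbar S2) a3)).
  apply: (@icell_cancel_r _ _ _ _ _ _ (iasci (arr G1) (fbar S1) a1)) => /=.
  rewrite -(awr3_conj (awr target m)) -(awr3_conj target).
  have -> : asc (arr G2) (fbar S2) (pp_pi2 P) • target
    • asci (arr G1) (fbar S1) (pp_pi1 P) = awr_along gamma ev1 ev2.
    by rewrite /target; vcr; rewrite asc_asci_r asc_asci vc_id_r.
  rewrite awr3_awr3_along /awl; vcr; rewrite !asc_asci_r asc_asci vc_id_r.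
  rewrite /theta2; vcr.
  have -> : arr G1 ◁ icell_inv (ivc t rv)
    = (arr G1 ◁ icell_inv rv) • (arr G1 ◁ icell_inv t) by rewrite -lw_vc.
  by vcr; rewrite (lw_inv _ (icell_invl t)) vc_id_r -!iawrE.
by rewrite -EL -ER.
Qed.

End Main.

Theorem propositionD1 :
  forall (B : bicategory) (W : arrow_class B)
    (HW : WBconditions W)
    (Hpc : pullback_closed W)
    (Hfull : forall (X Y : B) (w : hom X Y), W X Y w -> full w)
    (Hcofull : forall (X Y : B) (w : hom X Y), W X Y w -> cofull w)
    (pp : pullback_choice W)
    (sq : square_choice W)
    (X Y Z : B)
    (F1 F2 : span W X Y) (G1 G2 : span W Y Z)
    (beta : arr F1 ∘ pp_pi1 (leg_pullback pp F1 F2)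
            ⇒ arr F2 ∘ pp_pi2 (leg_pullback pp F1 F2))
    (gamma : arr G1 ∘ pp_pi1 (leg_pullback pp G1 G2)
             ⇒ arr G2 ∘ pp_pi2 (leg_pullback pp G1 G2)),
  let H5 := wb5 HW in
  let S1 := sq X Y Z F1 G1 in
  let S2 := sq X Y Z F2 G2 in
  let Pu := leg_pullback pp F1 F2 in
  let Pv := leg_pullback pp G1 G2 in
  let P := leg_pullback pp (span_comp sq F1 G1) (span_comp sq F2 G2) in
  forall (wu : hom (pp_ob P) (pp_ob Pu))
    (eu1 : pp_pi1 Pu ∘ wu = vbar S1 ∘ pp_pi1 P)
    (eu2 : pp_pi2 Pu ∘ wu = vbar S2 ∘ pp_pi2 P)
    (Hwu : awr_along (pp_rho Pu) eu1 eu2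
           = asc (leg F2) (vbar S2) (pp_pi2 P) • pp_rho P
             • asci (leg F1) (vbar S1) (pp_pi1 P)),
  invertible beta ->
  forall (wv : hom (pp_ob P) (pp_ob Pv))
    (ev1 : pp_pi1 Pv ∘ wv = fbar S1 ∘ pp_pi1 P)
    (ev2 : pp_pi2 Pv ∘ wv = fbar S2 ∘ pp_pi2 P)
    (Hwv : awr_along (pp_rho Pv) ev1 ev2
           = awr (icell_inv (sq_cell S2)) (pp_pi2 P)
             • awr_along beta eu1 eu2
             • awr (sq_cell S1) (pp_pi1 P)),
  same_class
    (hcomp sq H5 (cls (pullback_diagram pp H5 Hpc beta))
                 (cls (pullback_diagram pp H5 Hpc gamma)))
    (cls (pullback_diagram pp H5 Hpc
            (F1 := span_comp sq F1 G1) (F2 := span_comp sq F2 G2)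
            (asci (arr G2) (fbar S2) (pp_pi2 P)
             • awr_along gamma ev1 ev2
             • asc (arr G1) (fbar S1) (pp_pi1 P)))).
Proof.
move=> B W HW Hpc Hfull _ pp sq X Y Z F1 F2 G1 G2 beta gamma H5 S1 S2 Pu Pv P.
move=> wu eu1 eu2 Hwu Hbeta wv ev1 ev2 Hwv d.
set target := pullback_diagram pp H5 Hpc (_ • _ • _).
have key := @hcomp_diagram_equiv B W HW Hpc Hfull pp sq X Y Z F1 F2 G1 G2 beta
  gamma wu eu1 eu2 Hwu Hbeta wv ev1 ev2 Hwv.
(* Every diagram of the horizontal composite comes from some representatives and choices, all
   covered by [key]. *)
split=> [[d1' [d2' [c [[d1 [c1 [E1 E1']]] [[d2 [c2 [E2 E2']]] E]]]]] | E].
  apply: (diagram_equiv_trans HW Hfull) E.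
  by apply: (diagram_equiv_sym HW); apply: key E1 E1' E2 E2'.
set dbeta := pullback_diagram pp H5 Hpc beta.
set dgamma := pullback_diagram pp H5 Hpc gamma.
have refl := diagram_equiv_refl HW.
(* The converse inclusion requires one admissible choice at each stage. *)
have [c1] := lwhisk_data_exists HW Hfull sq dbeta G1.
have [c2] := rwhisk_data_exists HW Hfull sq F2 dgamma.
have [c] := vcomp_data_exists HW Hfull (lwhisk_diagram c1) (rwhisk_diagram c2).
exists (lwhisk_diagram c1), (rwhisk_diagram c2), c.
split; first by exists dbeta, c1; split; apply: refl.
split; first by exists dgamma, c2; split; apply: refl.
apply: (diagram_equiv_trans HW Hfull) E.
by apply: (key dbeta c1 _ dgamma c2); apply: refl.
Qed.
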